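(* Let $X$ be a locally coherent scheme and let $\mathscr{F}$ be a quasi-coherent sheaf on $X$. Then $\mathscr{F}$ is locally absolutely pure if and only if $\mathscr{F}$ is absolutely pure in the category of $\mathcal{O}_X$-modules.
   Context: A scheme $X$ is locally coherent if $\mathcal{O}_X(U)$ is a coherent ring for each affine open $U\subseteq X$. For a commutative ring $R$, an $R$-module $A$ is absolutely pure if it is a pure submodule of every $R$-module containing it, where a submodule $L\subseteq N$ is pure if $T\otimes_R L\to T\otimes_R N$ is injective for every $R$-module $T$. A quasi-coherent sheaf $\mathscr{F}$ is locally absolutely pure if $\mathscr{F}(U)$ is an absolutely pure $\mathcal{O}_X(U)$-module for every affine open $U\subseteq X$. An exact sequence $0\to\mathscr{F}\to\mathscr{G}$ of $\mathcal{O}_X$-modules is pure exact if $0\to\mathscr{M}\otimes\mathscr{F}\to\mathscr{M}\otimes\mathscr{G}$ is exact for every $\mathcal{O}_X$-module $\mathscr{M}$. An $\mathcal{O}_X$-module $\mathscr{F}$ is absolutely pure in the category of $\mathcal{O}_X$-modules if every exact sequence $0\to\mathscr{F}\to\mathscr{G}$ of $\mathcal{O}_X$-modules is pure exact. *)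

(* Defs.v *)
From HB Require Import structures.
From mathcomp Require Import all_boot all_order all_algebra.
From mathcomp Require Import all_classical topology ring.

Set Implicit Arguments.
Unset Strict Implicit.
Unset Printing Implicit Defensive.

Import GRing.Theory.

Local Open Scope classical_set_scope.
Local Open Scope ring_scope.
Local Open Scope quotient_scope.

(* Rings are commutative with unit and may be zero (comPzRingType), so that   *)
(* the empty open set has the zero ring of sections.                          *)

Definition selfmod (R : comPzRingType) : lmodType R :=
  GRing.Lmodule.clone R R^o _.

Definition in_span (R : comPzRingType) (M : lmodType R) n (a : 'I_n -> M)
  (x : M) := exists c : 'I_n -> R, x = \sum_(i < n) c i *: a i.

(* R^m -> R^n -> I -> 0 is exact: a generates I and b generates the syzygies. *)
Definition finitely_presented_ideal (R : comPzRingType) (I : set R) :=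
  exists (n : nat) (a : 'I_n -> R),
    (forall x, I x <-> in_span (M := selfmod R) a x) /\
    exists (m : nat) (b : 'I_m -> 'rV[R]_n),
      forall r : 'rV[R]_n, \sum_(i < n) r 0 i * a i = 0 <-> in_span b r.

Definition coherent_ring (R : comPzRingType) :=
  forall (n : nat) (a : 'I_n -> R),
    finitely_presented_ideal [set x | in_span (M := selfmod R) a x].

Section Tensor.
Variables (R : comPzRingType) (M N : lmodType R).

(* M (x) N is the quotient of the formal sums of pairs by the congruence      *)
(* generated by bilinearity.                                                  *)
Inductive tens_rel : seq (M * N) -> seq (M * N) -> Prop :=
| tens_refl s : tens_rel s s
| tens_sym s t : tens_rel s t -> tens_rel t s
| tens_trans s t u : tens_rel s t -> tens_rel t u -> tens_rel s u
| tens_cat s1 s2 t1 t2 :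
    tens_rel s1 t1 -> tens_rel s2 t2 -> tens_rel (s1 ++ s2) (t1 ++ t2)
| tens_comm s t : tens_rel (s ++ t) (t ++ s)
| tens_zero n : tens_rel [:: (0, n)] [::]
| tens_addl m m' n : tens_rel [:: (m + m', n)] [:: (m, n); (m', n)]
| tens_addr m n n' : tens_rel [:: (m, n + n')] [:: (m, n); (m, n')]
| tens_scale a m n : tens_rel [:: (a *: m, n)] [:: (m, a *: n)].

Definition tens_relb (s t : seq (M * N)) := `[< tens_rel s t >].

Lemma tens_relb_equiv : equiv_class_of tens_relb.
Proof.
split.
- by move=> s; apply/asboolP; exact: tens_refl.
- by move=> s t; apply/asboolP/asboolP; exact: tens_sym.
- by move=> s t u /asboolP st /asboolP tu; apply/asboolP; exact: tens_trans tu.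
Qed.

Canonical tens_equiv := EquivRelPack tens_relb_equiv.

Definition tensor := {eq_quot tens_equiv}.
HB.instance Definition _ := Choice.on tensor.
HB.instance Definition _ := EqQuotient.on tensor.

Definition tpi (s : seq (M * N)) : tensor := \pi_tensor s.

Lemma tpiP s t : tpi s = tpi t <-> tens_rel s t.
Proof.
split=> [st|st]; last by apply/eqmodP/asboolP.
by apply/asboolP; move/eqmodP: st.
Qed.

Lemma tpiK x : tpi (repr x) = x. Proof. exact: reprK. Qed.

Definition ptens (m : M) (n : N) : tensor := tpi [:: (m, n)].

Definition tensor_add (x y : tensor) := tpi (repr x ++ repr y).
Definition tensor_map1 (f : M -> M) (x : tensor) :=
  tpi [seq (f p.1, p.2) | p <- repr x].

Lemma tensor_addE s t : tensor_add (tpi s) (tpi t) = tpi (s ++ t).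
Proof. by apply/tpiP; apply: tens_cat; apply/tpiP; rewrite tpiK. Qed.

Lemma tens_rel_map1 (f : M -> M) : {morph f : x y / x + y} ->
  (forall a, {morph f : x / a *: x}) -> forall s t, tens_rel s t ->
  tens_rel [seq (f p.1, p.2) | p <- s] [seq (f p.1, p.2) | p <- t].
Proof.
move=> fD fZ s t; elim => {s t} /=.
- by move=> s; exact: tens_refl.
- by move=> s t _; exact: tens_sym.
- by move=> s t u _ + _; exact: tens_trans.
- by move=> *; rewrite !map_cat; exact: tens_cat.
- by move=> *; rewrite !map_cat; exact: tens_comm.
- by move=> n; rewrite -(scale0r 0) fZ scale0r; exact: tens_zero.
- by move=> *; rewrite fD; exact: tens_addl.
- by move=> *; exact: tens_addr.
- by move=> *; rewrite fZ; exact: tens_scale.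
Qed.

Lemma tensor_map1E (f : M -> M) : {morph f : x y / x + y} ->
  (forall a, {morph f : x / a *: x}) -> forall s,
  tensor_map1 f (tpi s) = tpi [seq (f p.1, p.2) | p <- s].
Proof.
by move=> fD fZ s; apply/tpiP/tens_rel_map1/tpiP => //; rewrite tpiK.
Qed.

Definition tensor_scale (a : R) := tensor_map1 ( *:%R a).

Lemma tensor_scaleE a s :
  tensor_scale a (tpi s) = tpi [seq (a *: p.1, p.2) | p <- s].
Proof.
apply: tensor_map1E => [x y|b x]; first exact: scalerDr.
by rewrite !scalerA mulrC.
Qed.

Lemma tensor_ind (P : tensor -> Prop) : (forall s, P (tpi s)) -> forall x, P x.
Proof. by move=> Ps x; rewrite -(tpiK x). Qed.

Lemma tensor_addA : associative tensor_add.
Proof.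
elim/tensor_ind=> s; elim/tensor_ind=> t; elim/tensor_ind=> u.
by rewrite !tensor_addE catA.
Qed.

Lemma tensor_addC : commutative tensor_add.
Proof.
elim/tensor_ind=> s; elim/tensor_ind=> t.
by rewrite !tensor_addE; apply/tpiP; exact: tens_comm.
Qed.

Lemma tensor_add0 : left_id (tpi [::]) tensor_add.
Proof. by elim/tensor_ind=> s; rewrite tensor_addE. Qed.

Lemma tpi_cons p s : tpi (p :: s) = tensor_add (ptens p.1 p.2) (tpi s).
Proof. by case: p => m n; rewrite /ptens tensor_addE. Qed.

Lemma tensor_addN : left_inverse (tpi [::]) (tensor_scale (-1)) tensor_add.
Proof.
elim/tensor_ind; elim=> [|[m n] s IHs].
  by rewrite tensor_scaleE tensor_addE.
rewrite tensor_scaleE /= !tpi_cons -tensor_scaleE /=.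
rewrite [tensor_add (ptens m n) _]tensor_addC -tensor_addA.
rewrite [tensor_add (tensor_scale _ _) _]tensor_addA IHs tensor_add0.
rewrite tensor_addE; apply/tpiP => /=.
apply: tens_trans (tens_sym (tens_addl _ _ _)) _.
by rewrite scaleN1r addNr; exact: tens_zero.
Qed.

HB.instance Definition _ := GRing.isZmodule.Build tensor
  tensor_addA tensor_addC tensor_add0 tensor_addN.

Lemma tensor_scaleA a b x :
  tensor_scale a (tensor_scale b x) = tensor_scale (a * b) x.
Proof.
elim/tensor_ind: x => s; rewrite !tensor_scaleE -map_comp.
by congr tpi; apply: eq_map => p /=; rewrite scalerA.
Qed.

Lemma tensor_scale1 : left_id 1 tensor_scale.
Proof.
elim/tensor_ind=> s; rewrite tensor_scaleE.
by congr tpi; rewrite -[RHS]map_id; apply: eq_map => -[m n]; rewrite scale1r.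
Qed.

Lemma tensor_scaleDr : right_distributive tensor_scale +%R.
Proof.
move=> a; elim/tensor_ind=> s; elim/tensor_ind=> t.
by rewrite /+%R /= tensor_addE !tensor_scaleE tensor_addE map_cat.
Qed.

Lemma tensor_scaleDl x : {morph tensor_scale^~ x : a b / a + b}.
Proof.
move=> a b; elim/tensor_ind: x; elim=> [|[m n] s IHs].
  by rewrite !tensor_scaleE /= addr0.
rewrite !tensor_scaleE /= !tpi_cons /= -!tensor_scaleE IHs.
have -> : ptens ((a + b) *: m) n = ptens (a *: m) n + ptens (b *: m) n.
  rewrite [RHS]/+%R /= tensor_addE; apply/tpiP; rewrite scalerDl.
  exact: tens_addl.
exact: addrACA.
Qed.

HB.instance Definition _ := GRing.Zmodule_isLmodule.Build R tensor
  tensor_scaleA tensor_scale1 tensor_scaleDr tensor_scaleDl.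

Lemma tpiD s t : tpi s + tpi t = tpi (s ++ t). Proof. exact: tensor_addE. Qed.
Lemma tpiZ a s : a *: tpi s = tpi [seq (a *: p.1, p.2) | p <- s].
Proof. exact: tensor_scaleE. Qed.

End Tensor.

(* The map induced by f and g, which need only be semilinear along a common   *)
(* ring morphism for it to be well defined.                                   *)
Definition tens_map (R R' : comPzRingType) (M N : lmodType R)
    (M' N' : lmodType R') (f : M -> M') (g : N -> N') (x : tensor M N) :
    tensor M' N' :=
  tpi [seq (f p.1, g p.2) | p <- repr x].

Section TensMap.
Variables (R R' : comPzRingType) (phi : R -> R').
Variables (M N : lmodType R) (M' N' : lmodType R').
Variables (f : M -> M') (g : N -> N').
Hypotheses (fD : {morph f : x y / x + y}) (gD : {morph g : x y / x + y}).
Hypotheses (fZ : forall a x, f (a *: x) = phi a *: f x).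
Hypotheses (gZ : forall a x, g (a *: x) = phi a *: g x).

Lemma tens_mapE s : tens_map f g (tpi s) = tpi [seq (f p.1, g p.2) | p <- s].
Proof.
have f0 : f 0 = 0 by apply: (addrI (f 0)); rewrite -fD !addr0.
have key (u v : seq (M * N)) : tens_rel u v ->
    tens_rel [seq (f p.1, g p.2) | p <- u] [seq (f p.1, g p.2) | p <- v].
  elim => {u v} /=.
  - by move=> u; exact: tens_refl.
  - by move=> u v _; exact: tens_sym.
  - by move=> u v w _ + _; exact: tens_trans.
  - by move=> *; rewrite !map_cat; exact: tens_cat.
  - by move=> *; rewrite !map_cat; exact: tens_comm.
  - by move=> n; rewrite f0; exact: tens_zero.
  - by move=> *; rewrite fD; exact: tens_addl.
  - by move=> *; rewrite gD; exact: tens_addr.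
  - by move=> *; rewrite fZ gZ; exact: tens_scale.
by apply/tpiP/key/tpiP; rewrite tpiK.
Qed.

Lemma tens_mapD : {morph tens_map f g : x y / x + y}.
Proof.
elim/tensor_ind=> s; elim/tensor_ind=> t.
by rewrite tpiD !tens_mapE tpiD map_cat.
Qed.

Lemma tens_mapZ a x : tens_map f g (a *: x) = phi a *: tens_map f g x.
Proof.
elim/tensor_ind: x => s; rewrite tpiZ !tens_mapE tpiZ -!map_comp.
by congr tpi; apply: eq_map => p /=; rewrite fZ.
Qed.

End TensMap.

Definition pure_mono (R : comPzRingType) (L N : lmodType R)
    (f : {linear L -> N}) :=
  forall T : lmodType R, injective (tens_map (@id T) f).

Definition absolutely_pure (R : comPzRingType) (A : lmodType R) :=
  forall (N : lmodType R) (f : {linear A -> N}), injective f -> pure_mono f.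

Record opens (X : topologicalType) :=
  Opens { oset :> set X; open_oset : open oset }.

Lemma opens_eq (X : topologicalType) (U V : opens X) :
  (U : set X) = V -> U = V.
Proof. by case: U V => [U oU] [V oV] /= UV; subst V; congr Opens. Qed.

Definition opensI (X : topologicalType) (U V : opens X) : opens X :=
  Opens (openI (open_oset U) (open_oset V)).

Lemma opensIl (X : topologicalType) (U V : opens X) : opensI U V `<=` U.
Proof. exact: subIsetl. Qed.

Lemma opensIr (X : topologicalType) (U V : opens X) : opensI U V `<=` V.
Proof. exact: subIsetr. Qed.

Definition is_sheaf (X : topologicalType) (S : opens X -> Type)
    (res : forall U V : opens X, V `<=` U -> S U -> S V) :=
  forall (I : Type) (U : opens X) (V : I -> opens X)
      (VU : forall i, V i `<=` U),
    (forall x, oset U x -> exists i, oset (V i) x) ->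
    forall s : (forall i, S (V i)),
      (forall i j, res _ _ (@opensIl X (V i) (V j)) (s i) =
                   res _ _ (@opensIr X (V i) (V j)) (s j)) ->
      exists! t : S U, forall i, res _ _ (VU i) t = s i.

Record ringSheaf (X : topologicalType) := RingSheaf {
  rsec :> opens X -> comPzRingType;
  rres : forall U V : opens X, V `<=` U -> {rmorphism rsec U -> rsec V};
  rres_id : forall (U : opens X) (h : U `<=` U) s, rres h s = s;
  rres_comp : forall (U V W : opens X) (h1 : V `<=` U) (h2 : W `<=` V)
    (h3 : W `<=` U) s, rres h2 (rres h1 s) = rres h3 s;
  rsheafP : is_sheaf (fun U V h => rres h : rsec U -> rsec V) }.

Record ringedSpace := RingedSpace {
  rspace :> topologicalType;
  rsheaf : ringSheaf rspace }.

Record presheafMod (X : ringedSpace) := PresheafMod {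
  psec :> forall U : opens X, lmodType (rsheaf X U);
  pres : forall U V : opens X, V `<=` U -> psec U -> psec V;
  presD : forall (U V : opens X) (h : V `<=` U), {morph pres h : s t / s + t};
  presZ : forall (U V : opens X) (h : V `<=` U) a s,
    pres h (a *: s) = rres (rsheaf X) h a *: pres h s;
  pres_id : forall (U : opens X) (h : U `<=` U) s, pres h s = s;
  pres_comp : forall (U V W : opens X) (h1 : V `<=` U) (h2 : W `<=` V)
    (h3 : W `<=` U) s, pres h2 (pres h1 s) = pres h3 s }.

Record sheafMod (X : ringedSpace) := SheafMod {
  sheaf_presheaf :> presheafMod X;
  sheafMod_sheaf : is_sheaf (@pres X sheaf_presheaf) }.

Record modHom (X : ringedSpace) (F G : presheafMod X) := ModHom {
  mhom :> forall U : opens X, {linear F U -> G U};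
  mhom_nat : forall (U V : opens X) (h : V `<=` U) s,
    mhom V (pres h s) = pres h (mhom U s) }.

(* Exactness of 0 -> F -> G: kernels of sheaves are computed sectionwise. *)
Definition exact_mono (X : ringedSpace) (F G : sheafMod X) (f : modHom F G) :=
  forall (U : opens X) (s : F U), f U s = 0 -> s = 0.

(* Families s(x), x in U, in prescribed abelian groups, together with a class *)
(* of basic families; the sections are the families that are locally basic.   *)
Record localFamily (X : topologicalType) := LocalFamily {
  fibre : X -> zmodType;
  basic : forall U : opens X, (forall x, oset U x -> fibre x) -> Prop;
  basic_res : forall (U V : opens X) (h : V `<=` U) s,
    basic s -> basic (fun x (Vx : oset V x) => s x (h x Vx));
  basic0 : forall U : opens X, basic (fun x (_ : oset U x) => 0);
  basicN : forall (U : opens X) s, basic s ->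
    basic (fun x (Ux : oset U x) => - s x Ux);
  basicD : forall (U : opens X) s t, basic s -> basic t ->
    basic (fun x (Ux : oset U x) => s x Ux + t x Ux) }.

Definition locally_basic (X : topologicalType) (L : localFamily X)
    (U : opens X) (s : forall x, oset U x -> fibre L x) :=
  forall x, oset U x -> exists (V : opens X) (h : V `<=` U),
    oset V x /\ basic (fun y (Vy : oset V y) => s y (h y Vy)).

Record lsec (X : topologicalType) (L : localFamily X) (U : opens X) := LSec {
  lval :> forall x, oset U x -> fibre L x;
  lvalP : locally_basic lval }.

Section LocalSections.
Variables (X : topologicalType) (L : localFamily X).
Implicit Types U V W : opens X.

HB.instance Definition _ U := gen_eqMixin (lsec L U).
HB.instance Definition _ U := gen_choiceMixin (lsec L U).

Lemma lsec_eq U (s t : lsec L U) : (forall x Ux, s x Ux = t x Ux) -> s = t.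
Proof.
case: s t => [s sP] [t tP] /= st.
have st' : s = t.
  apply: functional_extensionality_dep => x.
  exact: functional_extensionality_dep.
by subst t; congr LSec.
Qed.

Lemma fib_irr U (s : forall x, oset U x -> fibre L x) x (h h' : oset U x) :
  s x h = s x h'.
Proof. by congr (s x _). Qed.

Lemma lsec0P U : locally_basic (fun x (_ : oset U x) => 0 : fibre L x).
Proof. by move=> x Ux; exists U, (fun _ h => h); split=> //; exact: basic0. Qed.

Lemma lsecNP U (s : lsec L U) : locally_basic (fun x Ux => - s x Ux).
Proof.
move=> x /(lvalP s)[V [h [Vx sV]]]; exists V, h; split=> //.
exact: basicN sV.
Qed.

Lemma lsecDP U (s t : lsec L U) :
  locally_basic (fun x Ux => s x Ux + t x Ux).
Proof.
move=> x Ux; have [V [h [Vx sV]]] := lvalP s Ux.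
have [W [k [Wx tW]]] := lvalP t Ux.
exists (opensI V W), (fun y Iy => h y (opensIl Iy)); split=> //.
apply: basicD; first exact: (basic_res (@opensIl _ V W) sV).
have := basic_res (@opensIr _ V W) tW.
congr basic; apply: functional_extensionality_dep => y.
by apply: functional_extensionality_dep => Iy; exact: fib_irr.
Qed.

Definition lsec0 U := LSec (@lsec0P U).
Definition lsecN U s := LSec (@lsecNP U s).
Definition lsecD U s t := LSec (@lsecDP U s t).

Lemma lsec_addA U : associative (@lsecD U).
Proof. by move=> r s t; apply: lsec_eq => x Ux; exact: addrA. Qed.
Lemma lsec_addC U : commutative (@lsecD U).
Proof. by move=> s t; apply: lsec_eq => x Ux; exact: addrC. Qed.
Lemma lsec_add0 U : left_id (lsec0 U) (@lsecD U).
Proof. by move=> s; apply: lsec_eq => x Ux; exact: add0r. Qed.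
Lemma lsec_addN U : left_inverse (lsec0 U) (@lsecN U) (@lsecD U).
Proof. by move=> s; apply: lsec_eq => x Ux; exact: addNr. Qed.

HB.instance Definition _ U := GRing.isZmodule.Build (lsec L U)
  (@lsec_addA U) (@lsec_addC U) (@lsec_add0 U) (@lsec_addN U).

Lemma lresP U V (h : V `<=` U) (s : lsec L U) :
  locally_basic (fun x Vx => s x (h x Vx)).
Proof.
move=> x Vx; have [W [k [Wx sW]]] := lvalP s (h x Vx).
exists (opensI V W), (@opensIl _ V W); split=> //.
have := basic_res (@opensIr _ V W) sW.
congr basic; apply: functional_extensionality_dep => y.
by apply: functional_extensionality_dep => Iy; exact: fib_irr.
Qed.

Definition lres U V (h : V `<=` U) (s : lsec L U) : lsec L V :=
  LSec (lresP h s).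

Lemma lresD U V (h : V `<=` U) : {morph lres h : s t / s + t}.
Proof. by move=> s t; apply: lsec_eq. Qed.

Lemma lres_id U (h : U `<=` U) s : lres h s = s.
Proof. by apply: lsec_eq => x Ux /=; exact: fib_irr. Qed.

Lemma lres_comp U V W (h1 : V `<=` U) (h2 : W `<=` V) (h3 : W `<=` U) s :
  lres h2 (lres h1 s) = lres h3 s.
Proof. by apply: lsec_eq => x Wx /=; exact: fib_irr. Qed.

Lemma lsec_sheaf : is_sheaf lres.
Proof.
move=> I U V VU Ucov s scompat.
have sE i j x (hi : oset (V i) x) (hj : oset (V j) x) : s i x hi = s j x hj.
  have /(congr1 (fun t : lsec L (opensI (V i) (V j)) => t x (conj hi hj))) /=
    := scompat i j.
  by rewrite (fib_irr (s i) _ hi) (fib_irr (s j) _ hj).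
pose ix x (Ux : oset U x) := projT1 (cid (Ucov x Ux)).
have ixP x (Ux : oset U x) : oset (V (ix x Ux)) x := projT2 (cid (Ucov x Ux)).
pose t x (Ux : oset U x) : fibre L x := s _ x (ixP x Ux).
have tP : locally_basic t.
  move=> x Ux; have [W [h [Wx sW]]] := lvalP (s _) (ixP x Ux).
  exists W, (fun y Wy => VU _ y (h y Wy)); split=> //.
  move: sW; congr basic; apply: functional_extensionality_dep => y.
  by apply: functional_extensionality_dep => Wy; exact: sE.
exists (LSec tP); split=> [i|u uP].
  by apply: lsec_eq => x Vx; exact: sE.
by apply: lsec_eq => x Ux /=; rewrite /t -uP /=; exact: fib_irr.
Qed.

End LocalSections.

Record pregerm (X : ringedSpace) (P : presheafMod X) (x : X) := Pregerm {
  germ_open : opens X;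
  germ_in : oset germ_open x;
  germ_sec : P germ_open }.

Section Stalk.
Variables (X : ringedSpace) (P : presheafMod X) (x : X).
Implicit Types U V W : opens X.

HB.instance Definition _ := gen_eqMixin (pregerm P x).
HB.instance Definition _ := gen_choiceMixin (pregerm P x).

Definition germ_rel (g h : pregerm P x) := exists (W : opens X)
  (hg : W `<=` germ_open g) (hh : W `<=` germ_open h),
  oset W x /\ pres hg (germ_sec g) = pres hh (germ_sec h).

Definition germ_relb g h := `[< germ_rel g h >].

Lemma germ_relb_equiv : equiv_class_of germ_relb.
Proof.
split.
- move=> g; apply/asboolP.
  by exists (germ_open g), (fun _ h => h), (fun _ h => h); split=> //; case: g.
- by move=> g h; apply/asboolP/asboolP => -[W [a [b [Wx e]]]]; exists W, b, a.
- move=> h g k /asboolP[V [a [b [Vx e]]]] /asboolP[W [c [d [Wx f]]]].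
  apply/asboolP; exists (opensI V W).
  exists (fun y Iy => a y (opensIl Iy)), (fun y Iy => d y (opensIr Iy)).
  split=> //.
  rewrite -(pres_comp a (@opensIl _ V W)) e -(pres_comp d (@opensIr _ V W)) -f.
  by rewrite !(pres_comp _ _ (fun y Iy => b y (opensIl Iy))).
Qed.

Canonical germ_equiv := EquivRelPack germ_relb_equiv.

Definition stalk := {eq_quot germ_equiv}.
HB.instance Definition _ := Choice.on stalk.
HB.instance Definition _ := EqQuotient.on stalk.

Definition germ U (Ux : oset U x) (s : P U) : stalk :=
  \pi_stalk (Pregerm Ux s).

Lemma germP U V (Ux : oset U x) (Vx : oset V x) (s : P U) (t : P V) :
  germ Ux s = germ Vx t <-> exists (W : opens X) (hU : W `<=` U)
    (hV : W `<=` V), oset W x /\ pres hU s = pres hV t.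
Proof.
by split=> [/eqmodP/asboolP|H]; last by apply/eqmodP/asboolP.
Qed.

Lemma germ_res U V (h : V `<=` U) (Ux : oset U x) (Vx : oset V x) (s : P U) :
  germ Vx (pres h s) = germ Ux s.
Proof.
apply/germP; exists V, (fun _ k => k), h; split=> //.
exact: pres_comp.
Qed.

Lemma germ_irr U (Ux Ux' : oset U x) (s : P U) : germ Ux s = germ Ux' s.
Proof. by congr germ. Qed.

Lemma germ_repr (g : stalk) : germ (germ_in (repr g)) (germ_sec (repr g)) = g.
Proof.
by rewrite -[RHS](reprK g) /germ; congr (\pi_stalk _); case: (repr g).
Qed.

Lemma germ_ind1 (g : stalk) : exists U (Ux : oset U x) s, g = germ Ux s.
Proof.
by exists (germ_open (repr g)), (germ_in (repr g)), (germ_sec (repr g));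
  rewrite germ_repr.
Qed.

Lemma germ_ind2 (g h : stalk) : exists U (Ux : oset U x) s t,
  g = germ Ux s /\ h = germ Ux t.
Proof.
have [U [Ux [s ->]]] := germ_ind1 g; have [V [Vx [t ->]]] := germ_ind1 h.
exists (opensI U V), (conj Ux Vx), (pres (@opensIl _ U V) s).
by exists (pres (@opensIr _ U V) t); rewrite !germ_res.
Qed.

Lemma germ_ind3 (g h k : stalk) : exists U (Ux : oset U x) s t u,
  [/\ g = germ Ux s, h = germ Ux t & k = germ Ux u].
Proof.
have [U [Ux [s [t [-> ->]]]]] := germ_ind2 g h.
have [V [Vx [u ->]]] := germ_ind1 k.
exists (opensI U V), (conj Ux Vx), (pres (@opensIl _ U V) s).
exists (pres (@opensIl _ U V) t), (pres (@opensIr _ U V) u).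
by rewrite !germ_res.
Qed.

Definition stalk_add (g h : stalk) : stalk :=
  let a := repr g in let b := repr h in
  let U := germ_open a in let V := germ_open b in
  @germ (opensI U V) (conj (germ_in a) (germ_in b))
    (pres (@opensIl _ U V) (germ_sec a) + pres (@opensIr _ U V) (germ_sec b)).

Lemma stalk_addE U (Ux : oset U x) s t :
  stalk_add (germ Ux s) (germ Ux t) = germ Ux (s + t).
Proof.
rewrite /stalk_add; set a := repr (germ Ux s); set b := repr (germ Ux t).
have /germP[V [Va [VU [Vx ea]]]] := germ_repr (germ Ux s).
have /germP[W [Wb [WU [Wx eb]]]] := germ_repr (germ Ux t).
apply/germP; exists (opensI V W).
exists (fun y Iy => conj (Va y (opensIl Iy)) (Wb y (opensIr Iy))).
exists (fun y Iy => VU y (opensIl Iy)); split=> //.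
rewrite !presD; congr (_ + _).
  rewrite (pres_comp _ _ (fun y Iy => Va y (opensIl Iy))).
  by rewrite -(pres_comp Va (@opensIl _ V W)) ea; exact: pres_comp.
rewrite (pres_comp _ _ (fun y Iy => Wb y (opensIr Iy))).
by rewrite -(pres_comp Wb (@opensIr _ V W)) eb; exact: pres_comp.
Qed.

Lemma oset_top : oset (Opens (@openT X)) x. Proof. by []. Qed.

Definition stalk0 : stalk := germ oset_top 0.

Lemma pres0 U V (h : V `<=` U) : pres h (0 : P U) = 0.
Proof. by apply: (addrI (pres h 0)); rewrite -presD !addr0. Qed.

Lemma presN U V (h : V `<=` U) (s : P U) : pres h (- s) = - pres h s.
Proof. by apply: (addrI (pres h s)); rewrite -presD !subrr pres0. Qed.

Lemma stalk0E U (Ux : oset U x) : stalk0 = germ Ux 0.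
Proof.
by rewrite -(@pres0 (Opens (@openT X)) U (fun _ _ => I)) (germ_res _ oset_top).
Qed.

Definition stalk_opp (g : stalk) : stalk :=
  germ (germ_in (repr g)) (- germ_sec (repr g)).

Lemma stalk_oppE U (Ux : oset U x) s : stalk_opp (germ Ux s) = germ Ux (- s).
Proof.
have /germP[V [Va [VU [Vx ea]]]] := germ_repr (germ Ux s).
by apply/germP; exists V, Va, VU; split=> //; rewrite !presN ea.
Qed.

Lemma stalk_addA : associative stalk_add.
Proof.
move=> g h k; have [U [Ux [s [t [u [-> -> ->]]]]]] := germ_ind3 g h k.
by rewrite !stalk_addE addrA.
Qed.

Lemma stalk_addC : commutative stalk_add.
Proof.
move=> g h; have [U [Ux [s [t [-> ->]]]]] := germ_ind2 g h.
by rewrite !stalk_addE addrC.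
Qed.

Lemma stalk_add0 : left_id stalk0 stalk_add.
Proof.
move=> g; have [U [Ux [s ->]]] := germ_ind1 g.
by rewrite (stalk0E Ux) stalk_addE add0r.
Qed.

Lemma stalk_addN : left_inverse stalk0 stalk_opp stalk_add.
Proof.
move=> g; have [U [Ux [s ->]]] := germ_ind1 g.
by rewrite stalk_oppE stalk_addE addNr -stalk0E.
Qed.

HB.instance Definition _ := GRing.isZmodule.Build stalk
  stalk_addA stalk_addC stalk_add0 stalk_addN.

Lemma germD U (Ux : oset U x) s t : germ Ux (s + t) = germ Ux s + germ Ux t.
Proof. by rewrite [RHS]stalk_addE. Qed.

Lemma germN U (Ux : oset U x) s : germ Ux (- s) = - germ Ux s.
Proof. by rewrite [RHS]stalk_oppE. Qed.

Lemma germ0 U (Ux : oset U x) : germ Ux 0 = 0.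
Proof. by rewrite -stalk0E. Qed.

Definition stalk_scale U (Ux : oset U x) (a : rsheaf X U) (g : stalk) : stalk :=
  let V := germ_open (repr g) in
  @germ (opensI U V) (conj Ux (germ_in (repr g)))
    (rres _ (@opensIl _ U V) a *: pres (@opensIr _ U V) (germ_sec (repr g))).

Lemma stalk_scaleE U V (h : V `<=` U) (Ux : oset U x) (Vx : oset V x)
    (a : rsheaf X U) (s : P V) :
  stalk_scale Ux a (germ Vx s) = germ Vx (rres _ h a *: s).
Proof.
have /germP[W [Wa [WV [Wx ea]]]] := germ_repr (germ Vx s).
apply/germP; exists W, (fun y Wy => conj (h y (WV y Wy)) (Wa y Wy)), WV.
split=> //; rewrite !presZ (pres_comp _ _ Wa) ea.
by rewrite !(rres_comp _ _ (fun y Wy => h y (WV y Wy))).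
Qed.

Lemma germ_sub1 U (Ux : oset U x) (g : stalk) :
  exists V (h : V `<=` U) (Vx : oset V x) s, g = germ Vx s.
Proof.
have [V [Vx [s ->]]] := germ_ind1 g; exists (opensI U V), (@opensIl _ U V).
by exists (conj Ux Vx), (pres (@opensIr _ U V) s); rewrite germ_res.
Qed.

Lemma germ_sub2 U (Ux : oset U x) (g g' : stalk) : exists V (h : V `<=` U)
  (Vx : oset V x) s s', g = germ Vx s /\ g' = germ Vx s'.
Proof.
have [V [Vx [s [s' [-> ->]]]]] := germ_ind2 g g'.
exists (opensI U V), (@opensIl _ U V), (conj Ux Vx).
exists (pres (@opensIr _ U V) s), (pres (@opensIr _ U V) s').
by rewrite !germ_res.
Qed.

End Stalk.

Section Sheafify.
Variables (X : ringedSpace) (P : presheafMod X).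
Implicit Types U V W : opens X.

Definition basic_germ U (s : forall x, oset U x -> stalk P x) :=
  exists t : P U, forall x Ux, s x Ux = germ Ux t.

Lemma basic_germ_res U V (h : V `<=` U) (s : forall x, oset U x -> stalk P x) :
  basic_germ s -> basic_germ (fun x Vx => s x (h x Vx)).
Proof.
move=> [t st]; exists (pres h t) => x Vx.
by rewrite st (germ_res h (h x Vx)).
Qed.

Lemma basic_germ0 U : @basic_germ U (fun x Ux => 0).
Proof. by exists 0 => x Ux; rewrite germ0. Qed.

Lemma basic_germN U (s : forall x, oset U x -> stalk P x) :
  basic_germ s -> basic_germ (fun x Ux => - s x Ux).
Proof. by move=> [t st]; exists (- t) => x Ux; rewrite st germN. Qed.

Lemma basic_germD U (s s' : forall x, oset U x -> stalk P x) :
  basic_germ s -> basic_germ s' -> basic_germ (fun x Ux => s x Ux + s' x Ux).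
Proof.
by move=> [t st] [t' st']; exists (t + t') => x Ux; rewrite st st' germD.
Qed.

Definition germFamily :=
  LocalFamily basic_germ_res basic_germ0 basic_germN basic_germD.

Definition shsec U := lsec germFamily U.

HB.instance Definition _ U := GRing.Zmodule.on (shsec U).

Lemma sh_scaleP U (a : rsheaf X U) (s : shsec U) :
  locally_basic (L := germFamily) (fun x Ux => stalk_scale Ux a (s x Ux)).
Proof.
move=> x Ux; have [V [h [Vx [t st]]]] := lvalP s Ux.
exists V, h; split=> //; exists (rres _ h a *: t) => y Vy.
by rewrite st (stalk_scaleE h).
Qed.

Definition sh_scale U (a : rsheaf X U) (s : shsec U) : shsec U :=
  LSec (sh_scaleP a s).

Lemma sh_scaleA U a b (s : shsec U) :
  sh_scale a (sh_scale b s) = sh_scale (a * b) s.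
Proof.
apply: lsec_eq => x Ux /=; have [V [h [Vx [t ->]]]] := germ_sub1 Ux (s x Ux).
by rewrite !(stalk_scaleE h) scalerA rmorphM.
Qed.

Lemma sh_scale1 U : left_id 1 (@sh_scale U).
Proof.
move=> s; apply: lsec_eq => x Ux /=.
have [V [h [Vx [t ->]]]] := germ_sub1 Ux (s x Ux).
by rewrite (stalk_scaleE h) rmorph1 scale1r.
Qed.

Lemma sh_scaleDr U : right_distributive (@sh_scale U) +%R.
Proof.
move=> a s s'; apply: lsec_eq => x Ux /=.
have [V [h [Vx [t [t' [-> ->]]]]]] := germ_sub2 Ux (s x Ux) (s' x Ux).
by rewrite -germD !(stalk_scaleE h) scalerDr germD.
Qed.

Lemma sh_scaleDl U (s : shsec U) : {morph (@sh_scale U)^~ s : a b / a + b}.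
Proof.
move=> a b; apply: lsec_eq => x Ux /=.
have [V [h [Vx [t ->]]]] := germ_sub1 Ux (s x Ux).
by rewrite !(stalk_scaleE h) rmorphD scalerDl germD.
Qed.

HB.instance Definition _ U := GRing.Zmodule_isLmodule.Build (rsheaf X U)
  (shsec U) (@sh_scaleA U) (@sh_scale1 U) (@sh_scaleDr U) (@sh_scaleDl U).

Definition sh_res U V (h : V `<=` U) : shsec U -> shsec V := lres h.

Lemma sh_resZ U V (h : V `<=` U) a (s : shsec U) :
  sh_res h (a *: s) = rres _ h a *: sh_res h s.
Proof.
apply: lsec_eq => x Vx /=.
have [W [k [Wx [t ->]]]] := germ_sub1 Vx (s x (h x Vx)).
rewrite (stalk_scaleE (fun y Wy => h y (k y Wy))) (stalk_scaleE k).
by rewrite (rres_comp h k (fun y Wy => h y (k y Wy))).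
Qed.

Definition sheafify_pre : presheafMod X :=
  @PresheafMod X shsec sh_res (@lresD _ germFamily) sh_resZ
    (@lres_id _ germFamily) (@lres_comp _ germFamily).

Definition sheafify : sheafMod X :=
  @SheafMod X sheafify_pre (@lsec_sheaf _ germFamily).

End Sheafify.

Section SheafifyHom.
Variables (X : ringedSpace) (P Q : presheafMod X) (f : modHom P Q).
Implicit Types U V W : opens X.

Definition stalk_map x (g : stalk P x) : stalk Q x :=
  germ (germ_in (repr g)) (f _ (germ_sec (repr g))).

Lemma stalk_mapE U x (Ux : oset U x) s :
  stalk_map (germ Ux s) = germ Ux (f U s).
Proof.
have /germP[V [Va [VU [Vx ea]]]] := germ_repr (germ Ux s).
by apply/germP; exists V, Va, VU; split=> //; rewrite -!mhom_nat ea.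
Qed.

Lemma sheafify_mapP U (s : sheafify P U) :
  locally_basic (L := germFamily Q) (fun x Ux => stalk_map (lval s Ux)).
Proof.
move=> x Ux; have [V [h [Vx [t st]]]] := lvalP s Ux.
by exists V, h; split=> //; exists (f V t) => y Vy; rewrite st stalk_mapE.
Qed.

Definition sheafify_map U (s : sheafify P U) : sheafify Q U :=
  LSec (sheafify_mapP s).

Lemma sheafify_map_linear U : linear (@sheafify_map U).
Proof.
move=> a s s'; apply: lsec_eq => x Ux /=.
have [V [h [Vx [t [t' [-> ->]]]]]] := germ_sub2 Ux (lval s Ux) (lval s' Ux).
rewrite (stalk_scaleE h) -germD !stalk_mapE (stalk_scaleE h).
by rewrite linearD linearZ germD.
Qed.

HB.instance Definition _ U := GRing.isLinear.Build (rsheaf X U)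
  (sheafify P U) (sheafify Q U) *:%R (@sheafify_map U) (@sheafify_map_linear U).

Definition sheafify_hom : modHom (sheafify P) (sheafify Q).
Proof.
exists (fun U => @sheafify_map U : {linear _ -> _}).
by move=> U V h s; apply: lsec_eq.
Defined.

End SheafifyHom.

Section TensorSheaf.
Variables (X : ringedSpace) (M F : presheafMod X).

Definition tensor_res (U V : opens X) (h : V `<=` U) :
    tensor (M U) (F U) -> tensor (M V) (F V) :=
  tens_map (pres h) (pres h).

Lemma tensor_resE (U V : opens X) (h : V `<=` U) s :
  tensor_res h (tpi s) = tpi [seq (pres h p.1, pres h p.2) | p <- s].
Proof.
exact: (tens_mapE (presD h) (presD h) (presZ h) (presZ h)).
Qed.

Lemma tensor_res_id (U : opens X) (h : U `<=` U) s : tensor_res h s = s.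
Proof.
elim/tensor_ind: s => s; rewrite tensor_resE -[in RHS](map_id s).
by congr tpi; apply: eq_map => -[m n] /=; rewrite !pres_id.
Qed.

Lemma tensor_res_comp (U V W : opens X) (h1 : V `<=` U) (h2 : W `<=` V)
  (h3 : W `<=` U) s : tensor_res h2 (tensor_res h1 s) = tensor_res h3 s.
Proof.
elim/tensor_ind: s => s; rewrite !tensor_resE -map_comp.
by congr tpi; apply: eq_map => -[m n] /=; rewrite !(pres_comp h1 h2 h3).
Qed.

Definition tensor_presheaf : presheafMod X :=
  @PresheafMod X (fun U => tensor (M U) (F U)) tensor_res
    (fun U V h => tens_mapD (presD h) (presD h) (presZ h) (presZ h))
    (fun U V h => tens_mapZ (presD h) (presD h) (presZ h) (presZ h))
    tensor_res_id tensor_res_comp.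

Definition tensor_sheaf : sheafMod X := sheafify tensor_presheaf.

End TensorSheaf.

Section TensorHom.
Variables (X : ringedSpace) (M F G : presheafMod X) (f : modHom F G).

Definition tensor_hom_fun (U : opens X) :
    tensor_presheaf M F U -> tensor_presheaf M G U :=
  tens_map (@id (M U)) (f U).

Lemma tensor_hom_funE U s :
  @tensor_hom_fun U (tpi s) = tpi [seq (p.1, f U p.2) | p <- s].
Proof.
by apply: (tens_mapE (phi := id)) => // [x y|a x]; rewrite ?linearD ?linearZ.
Qed.

Lemma tensor_hom_linear U : linear (@tensor_hom_fun U).
Proof.
move=> a; elim/tensor_ind=> s; elim/tensor_ind=> t.
rewrite tpiZ tpiD !tensor_hom_funE tpiZ tpiD map_cat -!map_comp.
by [].
Qed.

HB.instance Definition _ U := GRing.isLinear.Build (rsheaf X U)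
  (tensor_presheaf M F U) (tensor_presheaf M G U) *:%R
  (@tensor_hom_fun U) (@tensor_hom_linear U).

Definition tensor_presheaf_hom :
  modHom (tensor_presheaf M F) (tensor_presheaf M G).
Proof.
exists (fun U => @tensor_hom_fun U : {linear _ -> _}).
move=> U V h; elim/tensor_ind=> s /=.
rewrite tensor_hom_funE !tensor_resE -!map_comp tensor_hom_funE -map_comp.
by congr tpi; apply: eq_map => -[m n] /=; rewrite mhom_nat.
Defined.

Definition tensor_hom : modHom (tensor_sheaf M F) (tensor_sheaf M G) :=
  sheafify_hom tensor_presheaf_hom.

End TensorHom.

Definition pure_exact (X : ringedSpace) (F G : sheafMod X) (f : modHom F G) :=
  forall M : sheafMod X, exact_mono (tensor_hom M f).

Definition absolutely_pure_sheaf (X : ringedSpace) (F : sheafMod X) :=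
  forall (G : sheafMod X) (f : modHom F G), exact_mono f -> pure_exact f.

Record spec (A : comPzRingType) := Spec {
  prime_set :> set A;
  prime0 : prime_set 0;
  primeD : forall a b, prime_set a -> prime_set b -> prime_set (a + b);
  primeMl : forall a b, prime_set b -> prime_set (a * b);
  prime1 : ~ prime_set 1;
  primeM : forall a b, prime_set (a * b) -> prime_set a \/ prime_set b }.

Section Zariski.
Variable A : comPzRingType.

HB.instance Definition _ := gen_eqMixin (spec A).
HB.instance Definition _ := gen_choiceMixin (spec A).

Definition zariski_open (U : set (spec A)) :=
  exists E : set A, U = [set p : spec A | ~ (E `<=` p)].

Lemma zariski_openT : zariski_open setT.
Proof.
exists setT; apply/seteqP; split=> // p _ Ep.
by apply: (@prime1 _ p); exact: Ep.
Qed.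

Lemma zariski_openI : setI_closed zariski_open.
Proof.
move=> _ _ [E ->] [F ->].
exists [set x | exists a b, [/\ E a, F b & x = a * b]].
apply/seteqP; split=> p /=.
  move=> [/existsNP[a /not_implyP[Ea pa]] /existsNP[b /not_implyP[Fb pb]]] EF.
  have pab : prime_set p (a * b) by apply: EF; exists a, b.
  by case: (primeM pab).
move=> EFp; split=> Ep; apply: EFp => _ [a [b [Ea Fb ->]]].
  by rewrite mulrC; apply: primeMl; exact: Ep.
by apply: primeMl; exact: Ep.
Qed.

Lemma zariski_open_bigU (I : Type) (f : I -> set (spec A)) :
  (forall i, zariski_open (f i)) -> zariski_open (\bigcup_i f i).
Proof.
move=> fo; exists [set a | exists i, projT1 (cid (fo i)) a].
apply/seteqP; split=> p /=.
  move=> [i _]; rewrite (projT2 (cid (fo i))) /= => Ep Up; apply: Ep => a Ea.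
  by apply: Up; exists i.
move=> /existsNP[a /not_implyP[[i Ea] pa]]; exists i => //.
by rewrite (projT2 (cid (fo i))) /= => /(_ a Ea).
Qed.

HB.instance Definition _ := isOpenTopological.Build (spec A)
  zariski_openT zariski_openI zariski_open_bigU.

End Zariski.

(* The localization M_p; the local ring A_p is the case M = A. *)
Section Localization.
Variables (A : comPzRingType) (p : spec A).

Record denom := Denom { dval : A; dvalP : ~ prime_set p dval }.

HB.instance Definition _ := gen_eqMixin denom.
HB.instance Definition _ := gen_choiceMixin denom.

Lemma denomMP (f g : denom) : ~ prime_set p (dval f * dval g).
Proof. by move=> /primeM[]; exact: dvalP. Qed.

Definition denom1 : denom := Denom (@prime1 _ p).
Definition denomM (f g : denom) : denom := Denom (@denomMP f g).

Section Module.
Variable M : lmodType A.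

Definition loc_rel (x y : M * denom) := exists u : denom,
  dval u *: (dval y.2 *: x.1) = dval u *: (dval x.2 *: y.1).

Definition loc_relb x y := `[< loc_rel x y >].

Lemma loc_relb_equiv : equiv_class_of loc_relb.
Proof.
split.
- by move=> x; apply/asboolP; exists denom1.
- by move=> x y; apply/asboolP/asboolP => -[u e]; exists u.
- move=> [n g] [m f] [k h] /asboolP[u /= e] /asboolP[v /= e'].
  apply/asboolP; exists (denomM g (denomM u v)) => /=.
  rewrite !scalerA in e e' *.
  transitivity ((dval v * dval h) *: ((dval u * dval g) *: m)).
    by rewrite scalerA; congr (_ *: _); ring.
  rewrite e scalerA.
  transitivity ((dval u * dval f) *: ((dval v * dval h) *: n)).
    by rewrite scalerA; congr (_ *: _); ring.
  by rewrite e' scalerA; congr (_ *: _); ring.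
Qed.

Canonical loc_equiv := EquivRelPack loc_relb_equiv.

Definition localization := {eq_quot loc_equiv}.
HB.instance Definition _ := Choice.on localization.
HB.instance Definition _ := EqQuotient.on localization.

Definition frac (m : M) (f : denom) : localization := \pi_localization (m, f).

Lemma fracP m f n g : frac m f = frac n g <->
  exists u : denom, dval u *: (dval g *: m) = dval u *: (dval f *: n).
Proof. by split=> [/eqmodP/asboolP|H]; last by apply/eqmodP/asboolP. Qed.

Lemma frac_repr z : frac (repr z).1 (repr z).2 = z.
Proof. by rewrite /frac -surjective_pairing; exact: reprK. Qed.

Lemma frac_ind (P : localization -> Prop) :
  (forall m f, P (frac m f)) -> forall z, P z.
Proof. by move=> H z; rewrite -(frac_repr z). Qed.

Definition loc_add (x y : localization) :=
  let m := (repr x).1 in let f := (repr x).2 in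
  let n := (repr y).1 in let g := (repr y).2 in
  frac (dval g *: m + dval f *: n) (denomM f g).

Definition loc_opp (x : localization) := frac (- (repr x).1) (repr x).2.

Lemma loc_addE m f n g :
  loc_add (frac m f) (frac n g) = frac (dval g *: m + dval f *: n) (denomM f g).
Proof.
rewrite /loc_add.
have /fracP[u eu] := frac_repr (frac m f).
have /fracP[v ev] := frac_repr (frac n g).
move: (repr (frac m f)) (repr (frac n g)) eu ev => [m' f'] [n' g'] /= eu ev.
apply/fracP; exists (denomM u v) => /=.
rewrite !scalerA in eu ev; rewrite !scalerDr !scalerA; congr (_ + _).
  transitivity ((dval v * dval g * dval g') *: ((dval u * dval f) *: m')).
    by rewrite scalerA; congr (_ *: _); ring.
  by rewrite eu scalerA; congr (_ *: _); ring.
transitivity ((dval u * dval f * dval f') *: ((dval v * dval g) *: n')).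
  by rewrite scalerA; congr (_ *: _); ring.
by rewrite ev scalerA; congr (_ *: _); ring.
Qed.

Lemma loc_oppE m f : loc_opp (frac m f) = frac (- m) f.
Proof.
have /fracP[u eu] := frac_repr (frac m f).
by apply/fracP; exists u; rewrite !scalerN eu.
Qed.

Lemma frac_eq m f n g : dval g *: m = dval f *: n -> frac m f = frac n g.
Proof. by move=> e; apply/fracP; exists denom1; rewrite e. Qed.

Lemma loc_addA : associative loc_add.
Proof.
elim/frac_ind=> m f; elim/frac_ind=> n g; elim/frac_ind=> k h.
rewrite !loc_addE; apply: frac_eq => /=.
rewrite !scalerDr !scalerA addrA.
by congr (_ *: _ + _ *: _ + _ *: _); ring.
Qed.

Lemma loc_addC : commutative loc_add.
Proof.
elim/frac_ind=> m f; elim/frac_ind=> n g.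
by rewrite !loc_addE addrC; apply: frac_eq; rewrite /= mulrC.
Qed.

Lemma loc_add0 : left_id (frac 0 denom1) loc_add.
Proof.
elim/frac_ind=> m f; rewrite loc_addE; apply: frac_eq.
by rewrite /= scaler0 add0r mul1r scale1r.
Qed.

Lemma loc_addN : left_inverse (frac 0 denom1) loc_opp loc_add.
Proof.
elim/frac_ind=> m f; rewrite loc_oppE loc_addE; apply: frac_eq.
by rewrite /= scalerN addNr !scaler0.
Qed.

HB.instance Definition _ := GRing.isZmodule.Build localization
  loc_addA loc_addC loc_add0 loc_addN.

Lemma frac0 : frac 0 denom1 = 0. Proof. by []. Qed.

Lemma fracD m f n g :
  frac m f + frac n g = frac (dval g *: m + dval f *: n) (denomM f g).
Proof. exact: loc_addE. Qed.

Lemma fracN m f : - frac m f = frac (- m) f. Proof. exact: loc_oppE. Qed.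

End Module.

Section Scale.
Variable M : lmodType A.

Definition loc_scale (z : localization (selfmod A)) (x : localization M) :
    localization M :=
  frac (((repr z).1 : A) *: (repr x).1) (denomM (repr z).2 (repr x).2).

Lemma loc_scaleE (a : A) f (m : M) g :
  loc_scale (frac (a : selfmod A) f) (frac m g) = frac (a *: m) (denomM f g).
Proof.
rewrite /loc_scale.
have /fracP[u eu] := frac_repr (frac (a : selfmod A) f).
have /fracP[v ev] := frac_repr (frac m g).
move: (repr (frac (a : selfmod A) f)) (repr (frac m g)) eu ev.
move=> [a' f'] [m' g'] /= eu ev.
apply/fracP; exists (denomM u v) => /=.
change (dval u * (dval f * a') = dval u * (dval f' * a)) in eu.
rewrite !scalerA in ev; rewrite !scalerA.
transitivity ((dval u * (dval f * a')) *: ((dval v * dval g) *: m')).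
  by rewrite scalerA; congr (_ *: _); ring.
by rewrite eu ev scalerA; congr (_ *: _); ring.
Qed.

End Scale.

Lemma loc_scaleA (M : lmodType A) a b (x : localization M) :
  loc_scale a (loc_scale b x) = loc_scale (loc_scale a b) x.
Proof.
elim/frac_ind: a => a f; elim/frac_ind: b => b g; elim/frac_ind: x => m h.
rewrite !loc_scaleE scalerA; apply: frac_eq => /=.
by rewrite mulrA.
Qed.

Lemma loc_scale1 (M : lmodType A) :
  left_id (frac (1 : selfmod A) denom1) (@loc_scale M).
Proof.
elim/frac_ind=> m f; rewrite loc_scaleE scale1r; apply: frac_eq => /=.
by rewrite mul1r.
Qed.

Lemma loc_scaleDr (M : lmodType A) : right_distributive (@loc_scale M) +%R.
Proof.
elim/frac_ind=> a f; elim/frac_ind=> m g; elim/frac_ind=> n h.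
rewrite fracD !loc_scaleE fracD; apply: frac_eq => /=.
rewrite !scalerDr !scalerA.
by congr (_ *: _ + _ *: _); ring.
Qed.

Lemma loc_scaleDl (M : lmodType A) (x : localization M) :
  {morph (@loc_scale M)^~ x : a b / a + b}.
Proof.
elim/frac_ind=> a f; elim/frac_ind=> b g; elim/frac_ind: x => m h.
rewrite fracD !loc_scaleE fracD; apply: frac_eq => /=.
rewrite !scalerDr !scalerA -!scalerDl; congr (_ *: _).
move: (a : A) (b : A) => {}a {}b.
change (dval f * dval h * (dval g * dval h) * (dval g * a + dval f * b) =
  dval f * dval g * dval h * (dval g * dval h) * a +
  dval f * dval g * dval h * (dval f * dval h) * b).
ring.
Qed.

Lemma loc_scaleC (a b : localization (selfmod A)) :
  loc_scale a b = loc_scale b a.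
Proof.
elim/frac_ind: a => a f; elim/frac_ind: b => b g.
rewrite !loc_scaleE; apply: frac_eq => /=.
move: (a : A) (b : A) => {}a {}b.
change (dval g * dval f * (a * b) = dval f * dval g * (b * a)).
ring.
Qed.

HB.instance Definition _ := GRing.Zmodule_isComPzRing.Build
  (localization (selfmod A))
  (@loc_scaleA (selfmod A)) loc_scaleC (@loc_scale1 (selfmod A))
  (fun x y z => loc_scaleDl z x y).

HB.instance Definition _ (M : lmodType A) :=
  GRing.Zmodule_isLmodule.Build (localization (selfmod A)) (localization M)
    (@loc_scaleA M) (@loc_scale1 M) (@loc_scaleDr M) (@loc_scaleDl M).

End Localization.

Section Tilde.
Variables (A : comPzRingType) (M : lmodType A).
Implicit Types U V W : opens (spec A).

Definition basic_frac U (s : forall p, oset U p -> localization p M) :=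
  exists (m : M) (f : A), forall p Up, exists fp : ~ prime_set p f,
    s p Up = frac m (Denom fp).

Lemma basic_frac_res U V (h : V `<=` U)
    (s : forall p, oset U p -> localization p M) :
  basic_frac s -> basic_frac (fun p Vp => s p (h p Vp)).
Proof. by move=> [m [f sE]]; exists m, f => p Vp; exact: sE. Qed.

Lemma basic_frac0 U : @basic_frac U (fun p Up => 0).
Proof. by exists 0, 1 => p Up; exists (@prime1 _ p). Qed.

Lemma basic_fracN U (s : forall p, oset U p -> localization p M) :
  basic_frac s -> basic_frac (fun p Up => - s p Up).
Proof.
move=> [m [f sE]]; exists (- m), f => p Up; have [fp ->] := sE p Up.
by exists fp; rewrite fracN.
Qed.

Lemma basic_fracD U (s t : forall p, oset U p -> localization p M) :
  basic_frac s -> basic_frac t -> basic_frac (fun p Up => s p Up + t p Up).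
Proof.
move=> [m [f sE]] [n [g tE]]; exists (g *: m + f *: n), (f * g) => p Up.
have [fp ->] := sE p Up; have [gp ->] := tE p Up.
by exists (@denomMP A _ (Denom fp) (Denom gp)); rewrite fracD.
Qed.

Definition fracFamily :=
  LocalFamily basic_frac_res basic_frac0 basic_fracN basic_fracD.

End Tilde.

Definition tilde_sec (A : comPzRingType) (M : lmodType A)
    (U : opens (spec A)) :=
  lsec (fracFamily M) U.

HB.instance Definition _ A M U := GRing.Zmodule.on (@tilde_sec A M U).

Section TildeModule.
Variables (A : comPzRingType) (U : opens (spec A)).

Lemma tilde_scaleP (M : lmodType A) (a : tilde_sec (selfmod A) U)
    (s : tilde_sec M U) :
  locally_basic (L := fracFamily M)
    (fun p Up => loc_scale (lval a Up) (lval s Up)).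
Proof.
move=> p Up; have [V [h [Vp [b [f aE]]]]] := lvalP a Up.
have [W [k [Wp [m [g sE]]]]] := lvalP s Up.
exists (opensI V W), (fun q Iq => h q (opensIl Iq)); split=> //.
exists ((b : A) *: m), (f * g) => q Iq.
have [fq eb] := aE q (opensIl Iq); have [gq em] := sE q (opensIr Iq).
exists (@denomMP A _ (Denom fq) (Denom gq)).
by rewrite eb (fib_irr (lval s) _ (k q (opensIr Iq))) em loc_scaleE.
Qed.

Definition tilde_scale M (a : tilde_sec (selfmod A) U) (s : tilde_sec M U) :
    tilde_sec M U :=
  LSec (tilde_scaleP a s).

Lemma tilde1P : locally_basic (L := fracFamily (selfmod A))
  (fun p (_ : oset U p) => 1 : localization p (selfmod A)).
Proof.
move=> p Up; exists U, (fun _ h => h); split=> //.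
by exists 1, 1 => q Uq; exists (@prime1 _ q).
Qed.

Definition tilde1 : tilde_sec (selfmod A) U := LSec tilde1P.

Lemma tilde_scaleA M a b (s : tilde_sec M U) :
  tilde_scale a (tilde_scale b s) = tilde_scale (tilde_scale a b) s.
Proof. by apply: lsec_eq => p Up; exact: loc_scaleA. Qed.

Lemma tilde_scale1 M : left_id tilde1 (@tilde_scale M).
Proof. by move=> s; apply: lsec_eq => p Up; exact: loc_scale1. Qed.

Lemma tilde_scaleDr M : right_distributive (@tilde_scale M) +%R.
Proof. by move=> a s t; apply: lsec_eq => p Up; exact: loc_scaleDr. Qed.

Lemma tilde_scaleDl M (s : tilde_sec M U) :
  {morph (@tilde_scale M)^~ s : a b / a + b}.
Proof. by move=> a b; apply: lsec_eq => p Up; exact: loc_scaleDl. Qed.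

Lemma tilde_scaleC (a b : tilde_sec (selfmod A) U) :
  tilde_scale a b = tilde_scale b a.
Proof. by apply: lsec_eq => p Up; exact: loc_scaleC. Qed.

HB.instance Definition _ := GRing.Zmodule_isComPzRing.Build
  (tilde_sec (selfmod A) U)
  (@tilde_scaleA (selfmod A)) tilde_scaleC (@tilde_scale1 (selfmod A))
  (fun x y z => tilde_scaleDl z x y).

HB.instance Definition _ M :=
  GRing.Zmodule_isLmodule.Build (tilde_sec (selfmod A) U) (tilde_sec M U)
    (@tilde_scaleA M) (@tilde_scale1 M) (@tilde_scaleDr M) (@tilde_scaleDl M).

End TildeModule.

Section SpecSheaf.
Variable A : comPzRingType.
Implicit Types U V W : opens (spec A).

Definition spec_res U V (h : V `<=` U) :
    tilde_sec (selfmod A) U -> tilde_sec (selfmod A) V :=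
  lres h.

Lemma spec_res_zmod U V (h : V `<=` U) : zmod_morphism (spec_res h).
Proof. by move=> s t; apply: lsec_eq. Qed.

Lemma spec_res_monoid U V (h : V `<=` U) : monoid_morphism (spec_res h).
Proof. by split=> [|s t]; apply: lsec_eq. Qed.

HB.instance Definition _ U V (h : V `<=` U) :=
  GRing.isZmodMorphism.Build _ _ (spec_res h) (spec_res_zmod h).
HB.instance Definition _ U V (h : V `<=` U) :=
  GRing.isMonoidMorphism.Build _ _ (spec_res h) (spec_res_monoid h).

Definition spec_sheaf : ringSheaf (spec A) :=
  @RingSheaf (spec A) (fun U => tilde_sec (selfmod A) U)
    (fun U V h => spec_res h : {rmorphism _ -> _})
    (@lres_id _ (fracFamily (selfmod A)))
    (@lres_comp _ (fracFamily (selfmod A)))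
    (@lsec_sheaf _ (fracFamily (selfmod A))).

Definition Spec_ringed : ringedSpace := RingedSpace spec_sheaf.

Definition tilde_presheaf (M : lmodType A) : presheafMod Spec_ringed.
Proof.
refine (@PresheafMod Spec_ringed (fun U => tilde_sec M U)
  (fun U V h => @lres _ (fracFamily M) U V h) (@lresD _ (fracFamily M)) _
  (@lres_id _ (fracFamily M)) (@lres_comp _ (fracFamily M))).
by move=> U V h a s; apply: lsec_eq.
Defined.

Definition tilde (M : lmodType A) : sheafMod Spec_ringed :=
  @SheafMod Spec_ringed (tilde_presheaf M) (@lsec_sheaf _ (fracFamily M)).

End SpecSheaf.

Record openEmbedding (Y X : topologicalType) := OpenEmbedding {
  emb :> Y -> X;
  emb_inj : injective emb;
  emb_cont : continuous emb;
  emb_open : forall W : opens Y, open (emb @` W) }.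

Definition imageOpen (Y X : topologicalType) (j : openEmbedding Y X)
    (W : opens Y) : opens X :=
  Opens (emb_open j W).

Lemma imageOpenS (Y X : topologicalType) (j : openEmbedding Y X)
    (W W' : opens Y) : W' `<=` W -> imageOpen j W' `<=` imageOpen j W.
Proof. exact: image_subset. Qed.

Arguments imageOpenS {Y X} j {W W'} h.

(* An isomorphism of Y with the open subspace j(Y) of X. *)
Record openImmersion (Y X : ringedSpace) := OpenImmersion {
  imm_emb :> openEmbedding Y X;
  imm_map : forall W : opens Y,
    {rmorphism rsheaf X (imageOpen imm_emb W) -> rsheaf Y W};
  imm_bij : forall W, bijective (imm_map W);
  imm_nat : forall (W W' : opens Y) (h : W' `<=` W) s,
    imm_map W' (rres _ (imageOpenS imm_emb h) s) = rres _ h (imm_map W s) }.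

Definition affine_open (X : ringedSpace) (U : opens X) :=
  exists (A : comPzRingType) (j : openImmersion (Spec_ringed A) X),
    (U : set X) = range j.

Record scheme := Scheme {
  scheme_space :> ringedSpace;
  scheme_affine : forall x : scheme_space,
    exists U : opens scheme_space, affine_open U /\ oset U x }.

(* An isomorphism of O_Y-modules between the restriction of F to Y and G. *)
Record restrictionIso (Y X : ringedSpace) (j : openImmersion Y X)
    (F : presheafMod X) (G : presheafMod Y) := RestrictionIso {
  riso :> forall W : opens Y, F (imageOpen j W) -> G W;
  riso_bij : forall W, bijective (@riso W);
  risoD : forall W, {morph @riso W : s t / s + t};
  risoZ : forall W a s, @riso W (a *: s) = imm_map j W a *: @riso W s;
  riso_nat : forall (W W' : opens Y) (h : W' `<=` W) s,
    @riso W' (pres (imageOpenS j h) s) = pres h (@riso W s) }.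

Definition quasi_coherent (X : ringedSpace) (F : sheafMod X) :=
  forall x : X, exists (A : comPzRingType)
    (j : openImmersion (Spec_ringed A) X) (M : lmodType A),
    range j x /\ inhabited (restrictionIso j F (tilde M)).

Definition locally_coherent (X : scheme) :=
  forall U : opens X, affine_open U -> coherent_ring (rsheaf X U).

Definition locally_absolutely_pure (X : scheme) (F : sheafMod X) :=
  forall U : opens X, affine_open U -> absolutely_pure (F U).

(* Main.v *)
(* A module is absolutely pure iff every finite linear system that is
   consistent (relations between the rows kill the right-hand side) is
   solvable: an element of the kernel of T (x) A -> T (x) N exhibits, via
   the equational criterion for the vanishing of a tensor, a system over A
   that is solvable in N. Both implications pass such systems between an
   affine open U and its points.

   (=>) A section of M (x) F dying in M (x) G yields, near each point, a
   system over a basic open D(g) of an affine U whose right-hand side is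
   consistent because F -> G is injective. Clearing denominators gives a
   system over O(U); coherence makes its relations finitely generated, so
   one power of g makes it consistent, F(U) solves it, and inverting g
   solves it on D(g).

   (<=) For a consistent system B x = y over U, let G be the pushout of F
   that adjoins a solution over U, and M the cokernel of the transpose of B
   on U, extended by zero. Then sum_i e_i (x) y_i vanishes in M (x) G, hence
   locally in M (x) F, which says that B x = y is locally solvable. As
   F(D(g)) is the localization of F(U), a partition of unity glues the local
   solutions. *)

From HB Require Import structures.
From mathcomp Require Import all_boot all_algebra.
From mathcomp Require Import all_classical topology ring.
Require Import Defs.

Set Implicit Arguments.
Unset Strict Implicit.
Unset Printing Implicit Defensive.

Import GRing.Theory.

Local Open Scope classical_set_scope.
Local Open Scope ring_scope.
Local Open Scope quotient_scope.

(** Finitely many localization statements each need their own power of [f]; by monotonicity the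
    maximum serves all of them at once. *)
Lemma uniform_exponent (I : finType) (P : I -> nat -> Prop) :
  (forall i k l, k <= l -> P i k -> P i l)%N ->
  (forall i, exists k, P i k) -> exists k, forall i, P i k.
Proof.
move=> Pmono /choice[k Pk]; exists (\max_i k i)%N => i.
exact: Pmono (leq_bigmax i) (Pk i).
Qed.

Lemma sum_deltaZ (R : comPzRingType) (V : lmodType R) n (i : 'I_n)
    (v : 'I_n -> V) : \sum_k (k == i)%:R *: v k = v i.
Proof.
rewrite (bigD1 i) //= eqxx scale1r big1 ?addr0 // => k /negPf->.
exact: scale0r.
Qed.

(** * Linear systems, tensor products and purity *)

Section Quotient.
Variables (R : comPzRingType) (V : lmodType R) (S : set V).
Hypotheses (S0 : S 0) (SD : forall u v, S u -> S v -> S (u + v)).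
Hypothesis SZ : forall a u, S u -> S (a *: u).

Let SN u : S u -> S (- u). Proof. by rewrite -scaleN1r; exact: SZ. Qed.

Definition quo_relb (u v : V) := `[< S (u - v) >].

Lemma quo_relb_equiv : equiv_class_of quo_relb.
Proof.
split.
- by move=> u; apply/asboolP; rewrite subrr.
- by move=> u v; apply/asboolP/asboolP => /SN; rewrite opprB.
- move=> v u w /asboolP uv /asboolP vw; apply/asboolP.
  by rewrite -(subrKA v); exact: SD.
Qed.

Canonical quo_equiv := EquivRelPack quo_relb_equiv.

Definition quomod := {eq_quot quo_equiv}.
HB.instance Definition _ := Choice.on quomod.
HB.instance Definition _ := EqQuotient.on quomod.

Definition qpi (u : V) : quomod := \pi_quomod u.

Lemma qpiP u v : qpi u = qpi v <-> S (u - v).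
Proof. by split=> [/eqmodP/asboolP|H]; last by apply/eqmodP/asboolP. Qed.

Lemma qpiK x : qpi (repr x) = x. Proof. exact: reprK. Qed.

Lemma quo_ind (P : quomod -> Prop) : (forall u, P (qpi u)) -> forall x, P x.
Proof. by move=> Pu x; rewrite -(qpiK x). Qed.

Definition quo_add (x y : quomod) := qpi (repr x + repr y).
Definition quo_opp (x : quomod) := qpi (- repr x).
Definition quo_scale (a : R) (x : quomod) := qpi (a *: repr x).

Lemma quo_addE u v : quo_add (qpi u) (qpi v) = qpi (u + v).
Proof.
apply/qpiP; have /qpiP Hu := qpiK (qpi u); have /qpiP Hv := qpiK (qpi v).
by rewrite opprD addrACA; exact: SD.
Qed.

Lemma quo_oppE u : quo_opp (qpi u) = qpi (- u).
Proof.
by apply/qpiP; have /qpiP/SN := qpiK (qpi u); rewrite opprD.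
Qed.

Lemma quo_scaleE a u : quo_scale a (qpi u) = qpi (a *: u).
Proof.
by apply/qpiP; have /qpiP/(SZ a) := qpiK (qpi u); rewrite scalerBr.
Qed.

Lemma quo_addA : associative quo_add.
Proof.
elim/quo_ind=> u; elim/quo_ind=> v; elim/quo_ind=> w.
by rewrite !quo_addE addrA.
Qed.

Lemma quo_addC : commutative quo_add.
Proof. by elim/quo_ind=> u; elim/quo_ind=> v; rewrite !quo_addE addrC. Qed.

Lemma quo_add0 : left_id (qpi 0) quo_add.
Proof. by elim/quo_ind=> u; rewrite quo_addE add0r. Qed.

Lemma quo_addN : left_inverse (qpi 0) quo_opp quo_add.
Proof. by elim/quo_ind=> u; rewrite quo_oppE quo_addE addNr. Qed.

HB.instance Definition _ := GRing.isZmodule.Build quomod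
  quo_addA quo_addC quo_add0 quo_addN.

Lemma qpiD u v : qpi (u + v) = qpi u + qpi v.
Proof. by rewrite [RHS]quo_addE. Qed.

Lemma quo_scaleA a b x : quo_scale a (quo_scale b x) = quo_scale (a * b) x.
Proof. by elim/quo_ind: x => u; rewrite !quo_scaleE scalerA. Qed.

Lemma quo_scale1 : left_id 1 quo_scale.
Proof. by elim/quo_ind=> u; rewrite quo_scaleE scale1r. Qed.

Lemma quo_scaleDr : right_distributive quo_scale +%R.
Proof.
move=> a; elim/quo_ind=> u; elim/quo_ind=> v.
by rewrite -qpiD !quo_scaleE -qpiD scalerDr.
Qed.

Lemma quo_scaleDl x : {morph quo_scale^~ x : a b / a + b}.
Proof.
by move=> a b; elim/quo_ind: x => u; rewrite !quo_scaleE -qpiD scalerDl.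
Qed.

HB.instance Definition _ := GRing.Zmodule_isLmodule.Build R quomod
  quo_scaleA quo_scale1 quo_scaleDr quo_scaleDl.

Lemma qpi_linear : linear qpi.
Proof. by move=> a u v; rewrite qpiD -quo_scaleE. Qed.

HB.instance Definition _ := GRing.isLinear.Build R V quomod *:%R qpi qpi_linear.

Lemma qpi_eq0 u : qpi u = 0 <-> S u.
Proof. by have := qpiP u 0; rewrite subr0. Qed.

End Quotient.

Section System.
Variables (R : comPzRingType) (M : lmodType R) (m n : nat).

Definition solvable (B : 'I_m -> 'I_n -> R) (y : 'I_m -> M) :=
  exists x : 'I_n -> M, forall i, y i = \sum_j B i j *: x j.

Definition consistent (B : 'I_m -> 'I_n -> R) (y : 'I_m -> M) :=
  forall r : 'I_m -> R, (forall j, \sum_i r i * B i j = 0) ->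
    \sum_i r i *: y i = 0.

Lemma solvable_consistent B y : solvable B y -> consistent B y.
Proof.
move=> [x yE] r rB; under eq_bigr do rewrite yE scaler_sumr.
rewrite exchange_big big1 // => j _.
by under eq_bigr do rewrite scalerA; rewrite -scaler_suml rB scale0r.
Qed.

End System.

(** * Syzygies over a coherent ring *)

Section Syzygies.
Variable R : comPzRingType.
Hypothesis Rcoh : coherent_ring R.

(** Coherence presents the ideal of the entries of [c] by some generators [a], perhaps not the
    entries themselves. With [c = P A] and [A = Q c], a relation [r] splits as
    [r (1 - P Q) + (r P) Q], where [r P] is a relation of [a]. *)
Lemma column_syzygies m (c : 'cV[R]_m) : exists k (K : 'M[R]_(k, m)),
  forall r : 'rV_m, r *m c = 0 <-> exists t : 'rV_k, r = t *m K.
Proof.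
have [n [a [aP [l [b bP]]]]] := Rcoh (fun i => c i 0).
pose A : 'cV[R]_n := \col_i a i; pose S : 'M[R]_(l, n) := \matrix_i b i.
have SA : S *m A = 0.
  apply/matrixP => i j; rewrite !mxE; transitivity (\sum_k b i 0 k * a k).
    by apply: eq_bigr => k _; rewrite !mxE.
  by apply/(bP (b i)); exists (fun k => (k == i)%:R); rewrite sum_deltaZ.
have /choice[p pE] i : exists p : 'rV[R]_n, c i 0 = (p *m A) 0 0.
  have /aP[d dE] : in_span (M := selfmod R) (fun i => c i 0) (c i 0).
    by exists (fun k => (k == i)%:R); rewrite sum_deltaZ.
  exists (\row_k d k); rewrite dE mxE.
  by apply: eq_bigr => k _; rewrite !mxE.
have /choice[q qE] i : exists q : 'rV[R]_m, a i = (q *m c) 0 0.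
  have [|d dE] := (aP (a i)).2.
    by exists (fun k => (k == i)%:R); rewrite sum_deltaZ.
  exists (\row_k d k); rewrite dE mxE.
  by apply: eq_bigr => k _; rewrite !mxE.
pose P : 'M[R]_(m, n) := \matrix_i p i; pose Q : 'M[R]_(n, m) := \matrix_i q i.
have PA : P *m A = c.
  apply/matrixP => i j; rewrite ord1 pE !mxE.
  by apply: eq_bigr => k _; rewrite !mxE.
have Qc : Q *m c = A.
  apply/matrixP => i j; rewrite ord1 [RHS]mxE qE !mxE.
  by apply: eq_bigr => k _; rewrite !mxE.
exists (m + l)%N, (col_mx (1%:M - P *m Q) (S *m Q)) => r.
split=> [rc|[t ->]]; last first.
  rewrite -mulmxA mul_col_mx mulmxBl mul1mx -!mulmxA Qc PA SA subrr col_mx0.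
  by rewrite mulmx0.
have /bP[d dE] : \sum_i (r *m P) 0 i * a i = 0.
  transitivity ((r *m P *m A) 0 0); last by rewrite -mulmxA PA rc mxE.
  by rewrite [RHS]mxE; apply: eq_bigr => k _; rewrite !mxE.
exists (row_mx r (\row_k d k)); rewrite mul_row_col mulmxBr mulmx1 !mulmxA.
suff <- : r *m P = \row_k d k *m S by rewrite subrK.
by rewrite dE mulmx_sum_row; apply: eq_bigr => k _; rewrite rowK mxE.
Qed.

(** Induction on the columns: relations of the first column are the [t K], and [t K] kills the
    remaining columns [B'] exactly when [t] is a relation of [K B']. *)
Lemma matrix_syzygies m n (B : 'M[R]_(m, n)) : exists k (K : 'M[R]_(k, m)),
  forall r : 'rV_m, r *m B = 0 <-> exists t : 'rV_k, r = t *m K.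
Proof.
elim: n m B => [|n IHn] m B.
  exists m, 1%:M => r; split=> [_|_]; first by exists r; rewrite mulmx1.
  by rewrite thinmx0.
move: B; rewrite -[n.+1]/(1 + n)%N => B.
rewrite -[B]hsubmxK; set c := lsubmx _; set B' := rsubmx _.
have [k [K KP]] := column_syzygies c; have [l [L LP]] := IHn k (K *m B').
exists l, (L *m K) => r; rewrite mul_mx_row; split=> [|[t ->]].
  rewrite -[0]row_mx0 => /eq_row_mx[/KP[t ->]].
  by rewrite -mulmxA => /LP[u ->]; exists u; rewrite mulmxA.
have -> : t *m (L *m K) *m c = 0 by apply/KP; exists (t *m L); rewrite mulmxA.
have -> : t *m (L *m K) *m B' = 0.
  by rewrite mulmxA -mulmxA; apply/LP; exists t.
exact: row_mx0.
Qed.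

Lemma syzygies m n (B : 'I_m -> 'I_n -> R) : exists k (K : 'I_k -> 'I_m -> R),
  (forall l j, \sum_i K l i * B i j = 0) /\
  forall r : 'I_m -> R, (forall j, \sum_i r i * B i j = 0) ->
    exists t : 'I_k -> R, forall i, r i = \sum_l t l * K l i.
Proof.
have [k [K KP]] := matrix_syzygies (\matrix_(i, j) B i j).
exists k, K; split=> [l j|r rB].
  have /matrixP/(_ 0 j) : row l K *m \matrix_(i, j) B i j = 0.
    by apply/KP; exists (delta_mx 0 l); rewrite rowE.
  rewrite !mxE => KB; rewrite -[RHS]KB.
  by apply: eq_bigr => i _; rewrite !mxE.
have /KP[t tE] : \row_i r i *m \matrix_(i, j) B i j = 0.
  apply/matrixP => i j; rewrite !mxE -[RHS](rB j).
  by apply: eq_bigr => k' _; rewrite !mxE.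
exists (t 0) => i; have /matrixP/(_ 0 i) := tE.
by rewrite !mxE.
Qed.

End Syzygies.

(** * The equational criterion for the vanishing of a tensor *)

Section TensorVanishing.
Variables (R : comPzRingType) (M N : lmodType R).
Implicit Types (s t : seq (M * N)) (rho : seq (M * seq (R * N))).

Lemma tpi_sum s : tpi s = \sum_(p <- s) ptens p.1 p.2.
Proof.
by elim: s => [|p s IHs]; rewrite ?big_nil // big_cons -IHs tpi_cons.
Qed.

Definition ptensl (n : N) (m : M) := ptens m n.

Lemma ptens_linearl (n : N) : linear (ptensl n).
Proof.
rewrite /ptensl => a m m'; rewrite [a *: ptens _ _]tpiZ [RHS]tpiD.
by apply/tpiP; exact: tens_addl.
Qed.

Lemma ptensZ a (m : M) (n : N) : ptens (a *: m) n = ptens m (a *: n).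
Proof. by apply/tpiP; exact: tens_scale. Qed.

Lemma ptens_linearr (m : M) : linear (@ptens R M N m).
Proof.
move=> a n n'.
have -> : a *: ptens m n = ptens m (a *: n) by rewrite -ptensZ [LHS]tpiZ.
by rewrite [RHS]tpiD; apply/tpiP; exact: tens_addr.
Qed.

HB.instance Definition _ n := GRing.isLinear.Build R M (tensor M N) *:%R
  (ptensl n) (ptens_linearl n).
HB.instance Definition _ m := GRing.isLinear.Build R N (tensor M N) *:%R
  (@ptens R M N m) (ptens_linearr m).

(** The easy half of the equational criterion: moving the coefficients across the tensor sign
    regroups the sum into the terms [(sum_i B i j e_i) (x) z_j]. *)
Lemma ptens_sum_eq0 m k (e : 'I_m -> M) (y : 'I_m -> N)
    (B : 'I_m -> 'I_k -> R) (z : 'I_k -> N) :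
  (forall i, y i = \sum_j B i j *: z j) ->
  (forall j, \sum_i B i j *: e i = 0) ->
  \sum_i ptens (e i) (y i) = 0.
Proof.
move=> yE Be.
under eq_bigr => i _ do rewrite yE linear_sum.
rewrite exchange_big big1 // => j _.
under eq_bigr => i _ do rewrite /= -ptensZ.
by rewrite -(linear_sum (ptensl (z j))) Be linear0.
Qed.

(* A formal sum of pairs, as an element of the direct sum of copies of [M]    *)
(* indexed by [N].                                                            *)
Definition fsum s (n : N) : M := \sum_(p <- s) (p.2 == n)%:R *: p.1.

(** An entry [(m, c)] of [rho] stands for [m] times the formal combination [c] of elements of [N].
    Those with [relations rho] make up the kernel of the map from the direct sum onto [M (x) N]. *)
Definition relsum rho (n : N) : M :=
  \sum_(p <- rho) (\sum_(q <- p.2) q.1 * (q.2 == n)%:R) *: p.1.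

Definition relations rho :=
  forall p, p \in rho -> \sum_(q <- p.2) q.1 *: q.2 = 0.

(** Only additivity in the second argument and the exchange of scalars contribute a relation of [N];
    the other generators of the congruence already hold in the direct sum. *)
Lemma tens_rel_fsum s t : tens_rel s t -> exists2 rho, relations rho &
  forall n, fsum s n = fsum t n + relsum rho n.
Proof.
elim=> {s t}.
- by move=> s; exists [::] => // n; rewrite /relsum big_nil addr0.
- move=> s t _ [rho rhoP e]; exists [seq (- p.1, p.2) | p <- rho].
    by move=> _ /mapP[p /rhoP p0 ->].
  move=> n; rewrite e -addrA -[LHS]addr0; congr (_ + _); apply/esym/eqP.
  rewrite addrC addr_eq0 /relsum big_map -sumrN; apply/eqP.
  by apply: eq_bigr => p _; rewrite scalerN.
- move=> s t u _ [rho rhoP e] _ [sigma sigmaP f]; exists (sigma ++ rho).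
    by move=> p; rewrite mem_cat => /orP[/sigmaP|/rhoP].
  by move=> n; rewrite e f /relsum big_cat addrA.
- move=> s1 s2 t1 t2 _ [rho rhoP e] _ [sigma sigmaP f]; exists (rho ++ sigma).
    by move=> p; rewrite mem_cat => /orP[/rhoP|/sigmaP].
  move=> n; have := e n; have := f n.
  rewrite /fsum /relsum !big_cat /= => -> ->.
  exact: addrACA.
- move=> s t; exists [::] => // n.
  by rewrite /relsum big_nil addr0 /fsum !big_cat /= addrC.
- move=> n; exists [::] => // n'.
  by rewrite /relsum /fsum big_cons !big_nil /= !addr0 scaler0.
- move=> m m' n; exists [::] => // n'.
  by rewrite /relsum /fsum !big_cons !big_nil /= !addr0 scalerDr.
- move=> m n n'; exists [:: (m, [:: (1, n + n'); (-1, n); (-1, n')])].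
    move=> p; rewrite inE => /eqP-> /=; rewrite !big_cons big_nil /=.
    by rewrite scale1r !scaleN1r addr0 -opprD subrr.
  move=> k; rewrite /relsum /fsum !big_cons !big_nil /= !addr0 -!scalerDl.
  by congr (_ *: _); ring.
- move=> a m n; exists [:: (m, [:: (a, n); (-1, a *: n)])].
    move=> p; rewrite inE => /eqP-> /=; rewrite !big_cons big_nil /=.
    by rewrite scaleN1r addr0 subrr.
  move=> k; rewrite /relsum /fsum !big_cons !big_nil /= !addr0 scalerA.
  by rewrite -!scalerDl; congr (_ *: _); ring.
Qed.

(* The auxiliary [mu i], which are paired with [0], cannot be dispensed with  *)
(* unless the [e i] generate [M].                                             *)
Lemma tensor_vanishing m (e : 'I_m -> M) (y : 'I_m -> N) :
    \sum_i ptens (e i) (y i) = 0 ->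
  exists k l (z : 'I_k -> N) (mu : 'I_l -> M) (B : 'I_m -> 'I_k -> R)
      (C : 'I_l -> 'I_k -> R),
    [/\ forall i, y i = \sum_j B i j *: z j,
        forall i, \sum_j C i j *: z j = 0
      & forall j, \sum_i B i j *: e i + \sum_i C i j *: mu i = 0].
Proof.
pose s := [seq (e i, y i) | i <- enum 'I_m].
have -> : \sum_i ptens (e i) (y i) = tpi s.
  by rewrite tpi_sum big_map big_enum.
case/tpiP/tens_rel_fsum => rho rhoP rhoE.
(* The [z j] are the distinct elements of [N] that occur anywhere, so that an identity in the direct
   sum can be read off coefficientwise. *)
pose supp := undup ([seq y i | i <- enum 'I_m] ++
  flatten [seq [seq q.2 | q <- p.2] | p <- rho]).
pose z (j : 'I_(size supp)) := nth 0 supp j.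
have suppE (F : N -> R) v : v \in supp ->
    (forall u, u != v -> F u = 0) -> \sum_j F (z j) *: z j = F v *: v.
  move=> v_in F0; rewrite -index_mem in v_in.
  have zv : z (Ordinal v_in) = v by rewrite /z nth_index // -index_mem.
  rewrite (bigD1 (Ordinal v_in)) //= zv big1 ?addr0 // => j jv.
  rewrite F0 ?scale0r // -zv /z nth_uniq ?undup_uniq //.
pose p i : M * seq (R * N) := nth (0, [::]) rho i.
(* The first components are negated: the identity in the direct sum puts [rho] opposite to [s], and
   the conclusion wants a vanishing sum. *)
exists (size supp), (size rho), z, (fun i : 'I_(size rho) => - (p i).1).
exists (fun i j => (y i == z j)%:R).
exists (fun i j => \sum_(q <- (p i).2) q.1 * (q.2 == z j)%:R); split=> [i|i|j].
- rewrite (suppE (fun n => (y i == n)%:R) (y i)) ?eqxx ?scale1r //.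
    by rewrite mem_undup mem_cat map_f ?mem_enum.
  by move=> u /negPf; rewrite eq_sym => ->.
- rewrite -[RHS](rhoP (p i)) ?mem_nth //.
  under eq_bigr do rewrite scaler_suml.
  rewrite exchange_big /= !big_seq; apply: eq_bigr => q q_in.
  rewrite (suppE (fun n => q.1 * (q.2 == n)%:R) q.2) ?eqxx ?mulr1 //.
    rewrite mem_undup mem_cat; apply/orP; right; apply/flattenP.
    exists [seq q.2 | q <- (p i).2]; last exact: map_f.
    by apply: map_f; rewrite mem_nth.
  by move=> u /negPf; rewrite eq_sym => ->; rewrite mulr0.
have := rhoE (z j); rewrite {1}/fsum big_map big_enum /= => ->.
rewrite /fsum big_nil add0r /relsum (big_nth (0, [::])) big_mkord.
by rewrite -big_split big1 //= => i _; rewrite scalerN subrr.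
Qed.

End TensorVanishing.

Lemma consistent_ext (R : comPzRingType) (M N : lmodType R)
    (f : {linear M -> N}) m n (B : 'I_m -> 'I_n -> R) (y : 'I_m -> M) :
  injective f -> consistent B (f \o y) -> consistent B y.
Proof.
move=> finj By r /By ry; apply: finj; rewrite linear0 -[RHS]ry linear_sum.
by apply: eq_bigr => i _; rewrite linearZ.
Qed.

Lemma tensor_sumP (R : comPzRingType) (M N : lmodType R) (x : tensor M N) :
  exists m (e : 'I_m -> M) (y : 'I_m -> N), x = \sum_i ptens (e i) (y i).
Proof.
elim/tensor_ind: x => s.
exists (size s), (fun i => (nth (0, 0) s i).1), (fun i => (nth (0, 0) s i).2).
by rewrite tpi_sum (big_nth (0, 0)) big_mkord.
Qed.

Lemma tens_map_sum (R : comPzRingType) (M N N' : lmodType R)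
    (f : {linear N -> N'}) m (e : 'I_m -> M) (y : 'I_m -> N) :
  tens_map (@id M) f (\sum_i ptens (e i) (y i)) = \sum_i ptens (e i) (f (y i)).
Proof.
pose s := [seq (e i, y i) | i <- enum 'I_m].
have -> : \sum_i ptens (e i) (y i) = tpi s by rewrite tpi_sum big_map big_enum.
rewrite (tens_mapE (phi := id)) // => [|u v|a u]; rewrite ?linearD ?linearZ //.
by rewrite tpi_sum big_map /s big_map big_enum.
Qed.

(** The auxiliary [mu i] of [tensor_vanishing] are appended to the [e i], paired with [0]: this does
    not change the tensor, and the equations [C z = 0] become further rows of the solvable
    system. *)
Lemma tensor_kernel (R : comPzRingType) (M N N' : lmodType R)
    (f : {linear N -> N'}) (x : tensor M N) : tens_map (@id M) f x = 0 ->
  exists m n (e : 'I_m -> M) (y : 'I_m -> N) (B : 'I_m -> 'I_n -> R),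
    [/\ x = \sum_i ptens (e i) (y i), forall j, \sum_i B i j *: e i = 0
      & solvable B (f \o y)].
Proof.
have [m [e [y ->]]] := tensor_sumP x; rewrite tens_map_sum.
move=> /tensor_vanishing[k [l [z [mu [B [C [yE Cz Be]]]]]]].
pose cas T (u : 'I_m -> T) (v : 'I_l -> T) (i : 'I_(m + l)) :=
  match fintype.split i with inl i => u i | inr i => v i end.
have casl T u v i : cas T u v (lshift l i) = u i.
  by rewrite /cas (unsplitK (inl _)).
have casr T u v i : cas T u v (rshift m i) = v i.
  by rewrite /cas (unsplitK (inr _)).
exists (m + l)%N, k, (cas _ e mu), (cas _ y (fun=> 0)), (cas _ B C); split.
- rewrite big_split_ord /= [X in _ + X]big1 ?addr0 => [|i _].
    by apply: eq_bigr => i _; rewrite !casl.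
  by rewrite !casr linear0.
- move=> j; rewrite big_split_ord -[RHS](Be j) /=.
  by congr (_ + _); apply: eq_bigr => i _; rewrite ?casl ?casr.
exists z => i; rewrite /= /cas; case: fintype.split => // i'.
by rewrite linear0 Cz.
Qed.

(** A tensor in the kernel yields a system solvable in [N], hence consistent there and, by
    injectivity, in [A]; a solution in [A] makes the tensor vanish. *)
Lemma solvable_pure (R : comPzRingType) (A : lmodType R) :
  (forall m n (B : 'I_m -> 'I_n -> R) (y : 'I_m -> A),
    consistent B y -> solvable B y) ->
  absolutely_pure A.
Proof.
move=> sol N f finj T x x' /eqP; rewrite -subr_eq0 => /eqP.
have -> : tens_map (@id T) f x - tens_map id f x' = tens_map id f (x - x').
  rewrite -!scaleN1r (tens_mapD (phi := id)) ?(tens_mapZ (phi := id)) //;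
  by move=> *; rewrite ?linearD ?linearZ.
case/tensor_kernel => m [n [e [y [B [xE Be /solvable_consistent]]]]].
move=> /(consistent_ext finj)/sol[z zE]; apply/eqP; rewrite -subr_eq0 xE.
by apply/eqP/(ptens_sum_eq0 zE).
Qed.

(** * The pushout and the cokernel attached to a system *)

Section Presentation.
Variables (R : comPzRingType) (A : lmodType R) (m n : nat).
Variables (B : 'I_m -> 'I_n -> R) (y : 'I_m -> A).

(* The quotient of [A * R^n] by these relations is the universal extension    *)
(* of [A] by a solution of [B x = y].                                         *)
Definition pushout_rel : set (A * 'rV[R]_n) :=
  [set u : A * 'rV[R]_n | exists r : 'I_m -> R, u.1 = \sum_i r i *: y i /\
    forall j, u.2 0 j = - \sum_i r i * B i j].

Lemma pushout_rel0 : pushout_rel 0.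
Proof.
exists (fun=> 0); split=> [|j]; first by rewrite big1 // => i; rewrite scale0r.
by rewrite mxE big1 ?oppr0 // => i; rewrite mul0r.
Qed.

Lemma pushout_relD u v : pushout_rel u -> pushout_rel v -> pushout_rel (u + v).
Proof.
move=> [r [u1 u2]] [s [v1 v2]]; exists (fun i => r i + s i); split=> [|j] /=.
  by rewrite u1 v1 -big_split; apply: eq_bigr => i _; rewrite scalerDl.
rewrite mxE u2 v2 -opprD -big_split; congr (- _).
by apply: eq_bigr => i _; rewrite mulrDl.
Qed.

Lemma pushout_relZ a u : pushout_rel u -> pushout_rel (a *: u).
Proof.
move=> [r [u1 u2]]; exists (fun i => a * r i); split=> [|j] /=.
  by rewrite u1 scaler_sumr; apply: eq_bigr => i _; rewrite scalerA.
rewrite mxE u2 mulrN mulr_sumr; congr (- _).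
by apply: eq_bigr => i _; rewrite mulrA.
Qed.

(** The column space of [B], in row vectors. The classes [e i] of the basis vectors generate the
    quotient, subject to [sum_i B i j e_i = 0] for each [j]. *)
Definition coker_rel : set 'rV[R]_m :=
  [set w : 'rV[R]_m |
    exists c : 'I_n -> R, forall i, w 0 i = \sum_j B i j * c j].

Lemma coker_rel0 : coker_rel 0.
Proof.
by exists (fun=> 0) => i; rewrite mxE big1 // => j; rewrite mulr0.
Qed.

Lemma coker_relD u v : coker_rel u -> coker_rel v -> coker_rel (u + v).
Proof.
move=> [c uE] [d vE]; exists (fun j => c j + d j) => i.
by rewrite mxE uE vE -big_split; apply: eq_bigr => j _; rewrite mulrDr.
Qed.

Lemma coker_relZ a u : coker_rel u -> coker_rel (a *: u).
Proof.
move=> [c uE]; exists (fun j => a * c j) => i.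
by rewrite mxE uE mulr_sumr; apply: eq_bigr => j _; rewrite mulrCA.
Qed.

(** So the classes of the [(0, delta_mx 0 j)] solve the system in the quotient. *)
Lemma pushout_rel_gen i :
  pushout_rel ((y i, 0) - \sum_j B i j *: (0, delta_mx 0 j)).
Proof.
exists (fun k => (k == i)%:R); split=> [|j] /=.
  rewrite (@big_morph _ _ fst 0 +%R 0 +%R (fun _ _ => erefl) erefl).
  by rewrite big1 ?sum_deltaZ ?subr0 // => j _; exact: scaler0.
rewrite (@big_morph _ _ snd 0 +%R 0 +%R (fun _ _ => erefl) erefl) /=.
have -> : \sum_j B i j *: delta_mx 0 j = \row_j B i j.
  by rewrite [RHS]row_sum_delta; apply: eq_bigr => k _; rewrite mxE.
by rewrite !mxE add0r (sum_deltaZ (V := selfmod R) i (B^~ j)).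
Qed.

Lemma coker_rel_gen j : coker_rel (\sum_i B i j *: delta_mx 0 i).
Proof.
exists (fun k => (k == j)%:R) => i; under [RHS]eq_bigr do rewrite mulrC.
rewrite (sum_deltaZ (V := selfmod R) j (B i)).
have -> : \sum_i B i j *: delta_mx 0 i = \row_i B i j.
  by rewrite [RHS]row_sum_delta; apply: eq_bigr => k _; rewrite mxE.
by rewrite mxE.
Qed.

(* The data produced by [tensor_vanishing] when the auxiliary elements are    *)
(* combinations, with coefficients [w], of the generators of the cokernel.    *)
Lemma coker_solvable k l (z : 'I_k -> A) (w : 'I_l -> 'rV[R]_m)
    (B' : 'I_m -> 'I_k -> R) (C : 'I_l -> 'I_k -> R) :
  (forall i, y i = \sum_j B' i j *: z j) ->
  (forall i, \sum_j C i j *: z j = 0) ->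
  (forall j, coker_rel (\row_i B' i j + \sum_l C l j *: w l)) ->
  solvable B y.
Proof.
move=> yE Cz /choice[c cE].
(* [c p] writes the [p]-th vector as [B] applied to coefficients; paired with [z], its [C] part
   drops out because [C z = 0], and its [B'] part is [y]. *)
exists (fun j => \sum_p c p j *: z p) => i.
transitivity (\sum_p (B' i p + \sum_l C l p * w l 0 i) *: z p).
  under [RHS]eq_bigr do rewrite scalerDl scaler_suml.
  rewrite big_split /= -yE exchange_big /= [X in _ + X]big1 ?addr0 //= => q _.
  under eq_bigr do rewrite mulrC -scalerA.
  by rewrite -scaler_sumr Cz scaler0.
under [RHS]eq_bigr do rewrite scaler_sumr.
rewrite exchange_big; apply: eq_bigr => p _ /=.
under [RHS]eq_bigr do rewrite scalerA.
rewrite -scaler_suml -cE !mxE summxE; congr ((_ + _) *: _).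
by apply: eq_bigr => q _; rewrite !mxE.
Qed.

End Presentation.

(** In the universal extension [N] the system has a solution, so with [T] the cokernel
    [sum_i e_i (x) y_i] dies in [T (x) N]. Purity makes it die in [T (x) A], where the vanishing
    criterion returns a solution. *)
Lemma pure_solvable (R : comPzRingType) (A : lmodType R) m n
    (B : 'I_m -> 'I_n -> R) (y : 'I_m -> A) :
  absolutely_pure A -> consistent B y -> solvable B y.
Proof.
move=> Apure By.
pose N := quomod (pushout_rel0 B y) (@pushout_relD _ _ _ _ B y)
  (@pushout_relZ _ _ _ _ B y).
pose T := quomod (coker_rel0 B) (@coker_relD _ _ _ B) (@coker_relZ _ _ _ B).
pose q : {linear _ -> N} := qpi (pushout_rel0 B y) (@pushout_relD _ _ _ _ B y)
  (@pushout_relZ _ _ _ _ B y).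
pose q' : {linear _ -> T} := qpi (coker_rel0 B) (@coker_relD _ _ _ B)
  (@coker_relZ _ _ _ B).
have q0 u : q u = 0 <-> pushout_rel B y u by exact: qpi_eq0.
have q'0 w : q' w = 0 <-> coker_rel B w by exact: qpi_eq0.
pose f a : N := q (a, 0).
have flin : linear f.
  move=> a u v; rewrite -linearP; congr (q _).
  by apply: injective_projections; rewrite /= ?scaler0 ?addr0.
pose fl := HB.pack_for {linear A -> N} f (GRing.isLinear.Build _ _ _ _ _ flin).
(* [(a, 0)] is a relation only for [a] of the form [sum_i r i y_i] with [r B = 0]; consistency says
   that such an [a] is zero. *)
have finj : injective fl.
  move=> u v uv; apply/eqP; rewrite -subr_eq0; apply/eqP.
  have : fl (u - v) = 0 by rewrite linearB uv subrr.
  move=> /q0[r [/= -> rB]]; apply: By => j.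
  by have := rB j; rewrite mxE => /esym/eqP; rewrite oppr_eq0 => /eqP.
pose e i := q' (delta_mx 0 i).
have eE (a : 'I_m -> R) : \sum_i a i *: e i = q' (\row_i a i).
  rewrite (row_sum_delta (\row_i a i)) linear_sum.
  by apply: eq_bigr => i _; rewrite linearZ mxE.
have : \sum_i ptens (e i) (y i) = 0.
  apply: (Apure N fl finj T); rewrite tens_map_sum.
  (* [0] is written as an empty sum so that [tens_map_sum] computes its image. *)
  have -> : 0 = \sum_(i < 0) ptens (0 : T) (0 : A) by rewrite big_ord0.
  rewrite tens_map_sum big_ord0.
  apply: (@ptens_sum_eq0 _ _ _ _ _ _ _ B (fun j => q (0, delta_mx 0 j))).
    move=> i; apply/eqP; rewrite -subr_eq0 -[fl _]/(q (y i, 0)).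
    under eq_bigr do rewrite -linearZ.
    by rewrite -linear_sum -linearB; apply/eqP/q0/pushout_rel_gen.
  move=> j; under eq_bigr do rewrite -linearZ.
  by rewrite -linear_sum; apply/q'0/coker_rel_gen.
move=> /tensor_vanishing[k [l [z [mu [B' [C [yE Cz B'e]]]]]]].
have /choice[w wE] i : exists w, mu i = q' w.
  by exists (repr (mu i)); rewrite -[LHS]qpiK.
apply: (coker_solvable (w := w) yE Cz) => j; apply/q'0.
rewrite linearD linear_sum -eE -[RHS](B'e j); congr (_ + _).
by apply: eq_bigr => i _; rewrite wE linearZ.
Qed.

(** * Sheaves that localize on basic opens *)

Section Sheaves.
Variables (X : topologicalType) (S : opens X -> Type).
Variable res : forall U V : opens X, V `<=` U -> S U -> S V.
Hypothesis Ssheaf : is_sheaf res.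
Hypothesis res_comp : forall (U V W : opens X) (h1 : V `<=` U) (h2 : W `<=` V)
  (h3 : W `<=` U) s, res h2 (res h1 s) = res h3 s.

Lemma sheaf_separated (I : Type) (U : opens X) (V : I -> opens X)
    (VU : forall i, V i `<=` U) (s t : S U) :
  (forall x, oset U x -> exists i, oset (V i) x) ->
  (forall i, res (VU i) s = res (VU i) t) -> s = t.
Proof.
move=> Ucov st.
have [i j|u [_ uP]] := Ssheaf VU Ucov (s := fun i => res (VU i) t).
  by rewrite !(res_comp _ _ (fun x Ix => VU i x (opensIl Ix))).
by rewrite -(uP s st) -(uP t).
Qed.

End Sheaves.

Lemma opens_sub_eq (X : topologicalType) (U V : opens X) :
  U `<=` V -> V `<=` U -> U = V.
Proof. by move=> UV VU; apply: opens_eq; apply/seteqP. Qed.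

Section Loci.
Variable X : ringedSpace.
Local Notation O := (rsheaf X).
Implicit Types (U V W D E : opens X) (F : presheafMod X).

Definition unit_on U V (h : V `<=` U) (f : O U) :=
  exists g, rres O h f * g = 1.

Lemma unit_onS U V W (h : V `<=` U) (k : W `<=` U) f :
  W `<=` V -> unit_on h f -> unit_on k f.
Proof.
move=> WV [g fg]; exists (rres O WV g).
by rewrite -(rres_comp h WV) -rmorphM fg rmorph1.
Qed.

Lemma unit_on_res U V W (h : V `<=` U) (k : W `<=` V) (l : W `<=` U) f :
  unit_on k (rres O h f) <-> unit_on l f.
Proof. by split=> -[g fg]; exists g; rewrite -fg (rres_comp h k l). Qed.

Lemma unit_onM U V (h : V `<=` U) f g :
  unit_on h (f * g) <-> unit_on h f /\ unit_on h g.
Proof.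
rewrite /unit_on rmorphM; split=> [[k fgk]|[[k fk] [l gl]]].
  split; first by exists (rres O h g * k); rewrite mulrA.
  by exists (rres O h f * k); rewrite mulrA [_ g * _]mulrC.
by exists (k * l); rewrite mulrACA fk gl mulr1.
Qed.

Lemma unit_onX U V (h : V `<=` U) f n : unit_on h f -> unit_on h (f ^+ n).
Proof.
by move=> [g fg]; exists (g ^+ n); rewrite rmorphXn -exprMn fg expr1n.
Qed.

Lemma unit_on_eq0 F U V (h : V `<=` U) f (s : F V) :
  unit_on h f -> rres O h f *: s = 0 -> s = 0.
Proof.
by move=> [g fg] fs; rewrite -[s]scale1r -fg mulrC -scalerA fs scaler0.
Qed.

(* The basic open [D(f)], described without coordinates on [U], so that the   *)
(* basic opens of different affine opens can be compared.                     *)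
Definition locus U D (h : D `<=` U) f :=
  unit_on h f /\ forall V (k : V `<=` U), unit_on k f -> V `<=` D.

Lemma locus_uniq U D D' (h : D `<=` U) (h' : D' `<=` U) f :
  locus h f -> locus h' f -> D = D'.
Proof.
by move=> [uD mD] [uD' mD']; apply: opens_sub_eq; [apply: mD' uD|apply: mD uD'].
Qed.

Lemma locus_res U D V (h : D `<=` U) (k : V `<=` U) f :
  locus h f -> locus (@opensIl _ V D) (rres O k f).
Proof.
move=> [uD mD]; split=> [|W l].
  apply/(unit_on_res k _ (fun x Ix => h x (opensIr Ix))).
  by apply: unit_onS uD; exact: opensIr.
move/(unit_on_res k _ (fun x Wx => k x (l x Wx)))/mD => WD x Wx.
by split; [exact: l|exact: WD].
Qed.

(** A basic open of a basic open is basic: up to a power of [f], a unit on [D], the function [g]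
    extends to [g'] over [U], and inverting [f * g'] amounts to inverting [f] and then [g]. *)
Lemma locus_nested U D E (h : D `<=` U) (k : E `<=` D) (l : E `<=` U) f g g' n :
  locus h f -> rres O h g' = rres O h f ^+ n * g -> locus k g ->
  locus l (f * g').
Proof.
move=> [uD mD] g'E [uE mE]; split=> [|V m].
  apply/unit_onM; split; first by apply: unit_onS uD.
  apply/(unit_on_res h k); rewrite g'E -rmorphXn; apply/unit_onM; split=> //.
  by apply/(unit_on_res h k l); apply: unit_onX; apply: unit_onS uD.
move=> /unit_onM[/mD VD]; move/(unit_on_res h VD); rewrite g'E.
by move=> /unit_onM[_ /mE].
Qed.

(* [F U -> F D] is the localization at [f] for every basic open [D] of [U].   *)
Definition localizes F U := forall f D (h : D `<=` U), locus h f ->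
  (forall s : F U, pres h s = 0 -> exists n, f ^+ n *: s = 0) /\
  (forall t : F D, exists n s, pres h s = rres O h f ^+ n *: t).

(** The structure sheaf as a module over itself, so that statements on [localizes] cover rings and
    modules alike. *)
Definition struct_presheaf : presheafMod X.
Proof.
refine (@PresheafMod X (fun U => selfmod (O U)) (fun U V h => rres O h)
  _ _ (@rres_id _ O) (@rres_comp _ O)).
- by move=> U V h s t; exact: rmorphD.
- by move=> U V h a s; exact: rmorphM.
Defined.

Definition struct_sheaf : sheafMod X :=
  @SheafMod X struct_presheaf (@rsheafP _ O).

(** By [locus_nested] a basic open of [D] is basic in [U], for [f * g']. The property over [U]
    applies there, and the surplus powers of [f] are units on [D]. *)
Lemma localizes_locus F U D (h : D `<=` U) f : localizes struct_sheaf U ->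
  localizes F U -> locus h f -> localizes F D.
Proof.
move=> OU FU fD g E k gE.
have [_ /(_ g)[n [g' g'E]]] := OU f D h fD.
change (rres O h g' = rres O h f ^+ n * g) in g'E.
have l : E `<=` U by move=> x Ex; exact/h/k.
have [FU0 FUs] := FU _ _ l (locus_nested (n := n) l fD g'E gE).
have [_ FDs] := FU _ _ h fD.
have fu m := unit_onX m fD.1.
split=> [s s0|t].
  have [m [s' s'E]] := FDs s.
  have [|m' s'0] := FU0 s'.
    by rewrite -(pres_comp h k) s'E presZ s0 scaler0.
  (* Collects the powers of [f] in [(f g')^m' s'], where [g' = f^n g] and [s' = f^m s] over [D]. *)
  exists m'; apply: (unit_on_eq0 (fu (m' + n * m' + m)%N)).
  rewrite -[RHS](pres0 F h) -s'0 presZ s'E !scalerA; congr (_ *: _).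
  rewrite !rmorphXn rmorphM g'E !exprMn -exprM !exprD; ring.
have [m [s sE]] := FUs t.
(* [(f g')^m] restricts to [f^(m + n m) g^m]; [g1] inverts the power of [f]. *)
have [g1 fg1] := fu (m + n * m)%N.
exists m, (g1 *: pres h s); rewrite presZ pres_comp sE scalerA.
have := congr1 (rres O k) fg1.
rewrite rmorphM rmorph1 (rres_comp h k l) => fg1'.
congr (_ *: _); rewrite rmorphM -(rres_comp h k l g') g'E -[RHS]mul1r -fg1'.
rewrite !rmorphM !rmorphXn (rres_comp h k l) !exprD exprM !exprMn; ring.
Qed.

(** Lifts of [f^k t] to the [V i] agree only over [D]. Their differences on overlaps vanish on the
    trace of [D], so one further power of [f] makes the lifts agree, and they glue. *)
Lemma localizes_glue (F : sheafMod X) n U (V : 'I_n -> opens X)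
    (VU : forall i, V i `<=` U) :
  (forall x, oset U x -> exists i, oset (V i) x) ->
  (forall i, localizes F (V i)) ->
  (forall i j, localizes F (opensI (V i) (V j))) -> localizes F U.
Proof.
move=> Ucov FV FVV f D h fD.
have sep := sheaf_separated (@sheafMod_sheaf _ F) (@pres_comp _ F).
split=> [s s0|t].
  have [i k l kl|i|k sk] := @uniform_exponent _
      (fun i k => rres O (VU i) f ^+ k *: pres (VU i) s = 0).
  - by move=> sk; rewrite -(subnK kl) exprD -scalerA sk scaler0.
  - apply: ((FV i _ _ _ (locus_res (VU i) fD)).1).
    rewrite (pres_comp _ _ (fun x Ix => h x (opensIr Ix))).
    by rewrite -(pres_comp h (@opensIr _ (V i) D)) s0 pres0.
  exists k; apply: (sep _ _ _ VU) => // i.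
  by rewrite presZ rmorphXn sk pres0.
have DU i : opensI (V i) D `<=` U by move=> x [_ /h].
have resD i (a : O U) : rres O (@opensIl _ (V i) D) (rres O (VU i) a) =
    rres O (@opensIr _ (V i) D) (rres O h a) by rewrite !(rres_comp _ _ (DU i)).
pose P i k := exists s : F (V i), pres (@opensIl _ (V i) D) s =
  pres (@opensIr _ (V i) D) (rres O h f ^+ k *: t).
have [i k l kl [s sP]|i|k Pk] := @uniform_exponent _ P.
- exists (rres O (VU i) f ^+ (l - k) *: s).
  rewrite presZ sP -[in RHS](subnK kl) exprD -scalerA [in RHS]presZ.
  by rewrite -!rmorphXn resD.
- have [_ /(_ (pres (@opensIr _ (V i) D) t))[k [s sE]]] :=
    FV i _ _ _ (locus_res (VU i) fD).
  by exists k, s; rewrite sE resD presZ rmorphXn.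
have [s sP] : exists s : forall i, F (V i), forall i,
    pres (@opensIl _ (V i) D) (s i) =
    pres (@opensIr _ (V i) D) (rres O h f ^+ k *: t).
  by exists (fun i => projT1 (cid (Pk i))) => i; exact: projT2 (cid (Pk i)).
pose VVU i j x (Ix : oset (opensI (V i) (V j)) x) := VU i x (opensIl Ix).
pose Q (p : 'I_n * 'I_n) N := rres O (VVU p.1 p.2) f ^+ N *:
  (pres (@opensIl _ (V p.1) (V p.2)) (s p.1) -
   pres (@opensIr _ (V p.1) (V p.2)) (s p.2)) = 0.
have [p N l Nl sN|[i j]|N sN] := @uniform_exponent _ Q.
- by rewrite /Q -(subnK Nl) exprD -scalerA sN scaler0.
- apply: ((FVV i j _ _ _ (locus_res (VVU i j) fD)).1) => /=.
  set W := opensI _ D.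
  have Wi : W `<=` opensI (V i) D by move=> x [[]].
  have Wj : W `<=` opensI (V j) D by move=> x [[]].
  have WD : W `<=` D by move=> x [].
  rewrite -[X in _ - X]scale1r -scaleNr presD presZ rmorphN rmorph1 scaleN1r.
  rewrite (pres_comp _ _ (fun x Wx => opensIl (Wi x Wx))).
  rewrite (pres_comp _ _ (fun x Wx => opensIl (Wj x Wx))).
  rewrite -(pres_comp (@opensIl _ (V i) D) Wi).
  rewrite -(pres_comp (@opensIl _ (V j) D) Wj) !sP.
  by rewrite !(pres_comp _ _ WD) subrr.
have [i j|u [uE _]] := @sheafMod_sheaf _ F _ _ _ VU Ucov
    (fun i => rres O (VU i) f ^+ N *: s i).
  rewrite !presZ !rmorphXn !(rres_comp _ _ (@VVU i j)).
  by apply/eqP; rewrite -subr_eq0 -scalerBr; apply/eqP/(sN (i, j)).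
exists (N + k)%N, u; apply: (sep _ _ _ (fun i => @opensIr _ (V i) D)).
  by move=> x Dx; have [i Vx] := Ucov x (h x Dx); exists i.
move=> i; rewrite (pres_comp _ _ (DU i)) -(pres_comp (VU i) (@opensIl _ _ _)).
by rewrite uE presZ sP rmorphXn resD exprD -scalerA !presZ !rmorphXn.
Qed.

End Loci.

(** * Linear systems and basic opens *)

Section LocalSystems.
Variable X : ringedSpace.
Local Notation O := (rsheaf X).
Implicit Types (U V W D E : opens X).

Section Localizes.
Variables (F : presheafMod X) (U D : opens X) (h : D `<=` U) (f : O U).
Hypotheses (FU : localizes F U) (fD : locus h f).

Lemma localizes_kill n (s : 'I_n -> F U) : (forall i, pres h (s i) = 0) ->
  exists k, forall i, f ^+ k *: s i = 0.
Proof.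
move=> s0; apply: uniform_exponent => [i k l kl sk|i].
  by rewrite -(subnK kl) exprD -scalerA sk scaler0.
exact: (FU fD).1.
Qed.

Lemma localizes_lift n (t : 'I_n -> F D) : exists k (s : 'I_n -> F U),
  forall i, pres h (s i) = rres O h f ^+ k *: t i.
Proof.
pose P i k := exists s, pres h s = rres O h f ^+ k *: t i.
have [i k l kl [s sP]|i|k Pk] := @uniform_exponent _ P.
- exists (f ^+ (l - k) *: s).
  by rewrite presZ sP scalerA rmorphXn -exprD subnK.
- exact: (FU fD).2.
exists k, (fun i => projT1 (cid (Pk i))) => i; exact: projT2 (cid (Pk i)).
Qed.

End Localizes.

(** A relation over [D] times a power of [f] lifts to [U], where another power makes it a true
    relation; it kills [y] over [U], and on [D] the powers of [f] cancel. *)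
Lemma consistent_locus (F : presheafMod X) U D (h : D `<=` U) f m n
    (B : 'I_m -> 'I_n -> O U) (y : 'I_m -> F U) :
  localizes (struct_sheaf X) U -> locus h f -> consistent B y ->
  consistent (fun i j => rres O h (B i j)) (pres h \o y).
Proof.
move=> OU fD By r rB.
have [k [s sE]] := localizes_lift OU fD r.
have [j|l sB] := localizes_kill OU fD (s := fun j => \sum_i s i * B i j).
  change (rres O h (\sum_i (s i : O U) * B i j) = 0).
  rewrite -[RHS](mulr0 (rres O h f ^+ k)) -(rB j) mulr_sumr rmorph_sum.
  apply: eq_bigr => i _.
  by rewrite rmorphM (sE i : rres O h (s i) = _ * r i) mulrA.
have /(congr1 (pres h)) : \sum_i (f ^+ l * s i) *: y i = 0.
  apply: By => j; rewrite -[RHS](sB j) [RHS]mulr_sumr.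
  by apply: eq_bigr => i _; rewrite mulrA.
rewrite pres0 => ry.
apply: (unit_on_eq0 (unit_onX (l + k) fD.1)); rewrite -[RHS]ry.
rewrite (big_morph (pres h) (presD h) (pres0 _ h)) scaler_sumr.
apply: eq_bigr => i _; rewrite presZ scalerA rmorphM exprD rmorphM !rmorphXn.
by rewrite (sE i : rres O h (s i) = _ * r i) mulrA.
Qed.

(* Coherence bounds the exponents needed to clear denominators uniformly over *)
(* all relations between the rows of the system.                              *)
Lemma solvable_locus (F : presheafMod X) U D (h : D `<=` U) f m n
    (B : 'I_m -> 'I_n -> O D) (y : 'I_m -> F D) :
  localizes (struct_sheaf X) U -> localizes F U -> coherent_ring (O U) ->
  absolutely_pure (F U) -> locus h f -> consistent B y -> solvable B y.
Proof.
move=> OU FU Ocoh Fpure fD By.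
have fu k : unit_on h (f ^+ k) by exact/unit_onX/fD.1.
have [k [B' B'E]] : exists k (B' : 'I_m -> 'I_n -> O U), forall i j,
    rres O h (B' i j) = rres O h f ^+ k * B i j.
  pose P i k := exists B' : 'I_n -> O U, forall j,
    rres O h (B' j) = rres O h f ^+ k * B i j.
  have [i k l kl [s sP]|i|k Pk] := @uniform_exponent _ P.
  - exists (fun j => f ^+ (l - k) * s j) => j.
    by rewrite rmorphM sP mulrA rmorphXn -exprD subnK.
  - by have [k [s sE]] := localizes_lift OU fD (B i); exists k, s.
  exists k, (fun i => projT1 (cid (Pk i))) => i; exact: projT2 (cid (Pk i)).
have [l [y' y'E]] := localizes_lift FU fD y.
have [q [K [KB' KP]]] := syzygies Ocoh B'.
(* Over [D] the rows of [K] are relations of [B], since [B'] is a unit multiple of it, so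
   consistency makes each [K y'] vanish there; the rows are finitely many, so one power of [f] kills
   all of these over [U]. *)
have [i|N Ky] := localizes_kill FU fD (s := fun p => \sum_i K p i *: y' i).
  rewrite (big_morph (pres h) (presD h) (pres0 _ h)).
  under eq_bigr do rewrite presZ y'E scalerA mulrC -scalerA.
  rewrite -scaler_sumr By ?scaler0 // => j.
  apply: (unit_on_eq0 (F := struct_sheaf X) (fu k)).
  rewrite -[RHS](rmorph0 (rres O h)) -(KB' i j) rmorph_sum [LHS]mulr_sumr.
  by apply: eq_bigr => i' _; rewrite rmorphM B'E rmorphXn mulrCA.
have [|x xE] := pure_solvable (B := B') (y := fun i => f ^+ N *: y' i) Fpure.
  move=> r /KP[t tE].
  under eq_bigr do rewrite tE scaler_suml.
  rewrite exchange_big big1 //= => p _.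
  under eq_bigr do rewrite scalerA mulrAC -!scalerA.
  by rewrite -!scaler_sumr Ky scaler0.
have [g fg] := fu (N + l)%N.
(* From [f^N y' = B' x], with [y' = f^l y] and [B' = f^k B] over [D], dividing by [f^(N + l)] gives
   the solution. *)
exists (fun j => (g * rres O h f ^+ k) *: pres h (x j)) => i.
have := congr1 (pres h) (xE i); rewrite presZ y'E rmorphXn scalerA -exprD.
rewrite (big_morph (pres h) (presD h) (pres0 _ h)) => /(congr1 ( *:%R g)).
rewrite scalerA -rmorphXn mulrC fg scale1r => ->; rewrite scaler_sumr.
apply: eq_bigr => j _; rewrite presZ B'E !scalerA; congr (_ *: _); ring.
Qed.

Lemma solvable_res (F : presheafMod X) U V (h : V `<=` U) m n
    (B : 'I_m -> 'I_n -> O U) (y : 'I_m -> F U) :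
  solvable B y -> solvable (fun i j => rres O h (B i j)) (pres h \o y).
Proof.
move=> [x xE]; exists (pres h \o x) => i /=.
rewrite xE (big_morph (pres h) (presD h) (pres0 _ h)).
by apply: eq_bigr => j _; rewrite presZ.
Qed.

Definition loci_basis U := forall W x, oset U x -> oset W x ->
  exists f D (h : D `<=` U), [/\ locus h f, oset D x & D `<=` W].

(** Quasi-compactness for covers by basic opens with a property [Q], together with partitions of
    unity. All powers are included because the exponent to be cleared is known only once the cover
    is fixed. *)
Definition loci_compact U := forall Q : opens X -> Prop,
  (forall x, oset U x -> exists f D (h : D `<=` U),
    [/\ locus h f, oset D x & Q D]) ->
  exists n (f : 'I_n -> O U) (D : 'I_n -> opens X) (h : forall i, D i `<=` U),
    [/\ forall i, locus (h i) (f i), forall i, Q (D i),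
        forall x, oset U x -> exists i, oset (D i) x
      & forall k, exists c : 'I_n -> O U, \sum_i c i * f i ^+ k = 1].

(** What affineness provides, phrased with units and restrictions only, so that it makes sense for
    an open of any ringed space and passes through open immersions. *)
Definition affine_like U :=
  [/\ loci_basis U, loci_compact U & localizes (struct_sheaf X) U].

(** A basic open [D] of [U] inside [V] contains a basic open of [V] around [x], which by
    [locus_nested] is basic in [U] as well. Finitely many such opens cover [U], and [localizes_glue]
    applies. *)
Lemma localizes_local (F : sheafMod X) U : affine_like U ->
  (forall x, oset U x ->
    exists V, [/\ oset V x, affine_like V & localizes F V]) ->
  localizes F U.
Proof.
move=> [Ubas Ucomp OU] FV.
pose Q D := localizes (struct_sheaf X) D /\ localizes F D.
have [x Ux|n [f [D [h [fD QD Dcov _]]]]] := Ucomp Q.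
  have [V [Vx [Vbas _ OV] {}FV]] := FV x Ux.
  have [g [D [h [gD Dx DV]]]] := Ubas V x Ux Vx.
  have [g' [D' [h' [gD' D'x D'D]]]] := Vbas D x Vx Dx.
  have [_ /(_ (rres O DV g'))[k [s sE]]] := OU _ _ _ gD.
  have eD' : opensI D D' = D'.
    by apply: opens_sub_eq => [|y D'y]; [exact: opensIr|split=> //; exact: D'D].
  have l : opensI D D' `<=` U by move=> y [/h].
  exists (g * s), (opensI D D'), l; split=> //.
    exact: (locus_nested (g' := s) l gD sE (locus_res DV gD')).
  by rewrite eD'; split; apply: localizes_locus gD'.
apply: (localizes_glue h Dcov) => [i|i j]; first exact: (QD i).2.
exact: localizes_locus (QD i).1 (QD i).2 (locus_res (h i) (fD j)).
Qed.

(** Over a finite basic cover, clearing denominators solves [B x = f_q^k y] over [U] for each [q]; a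
    partition of unity [sum_q c_q f_q^k = 1] combines the solutions. *)
Lemma solvable_local (F : presheafMod X) U m n (B : 'I_m -> 'I_n -> O U)
    (y : 'I_m -> F U) : affine_like U -> localizes F U ->
  (forall x, oset U x -> exists W (k : W `<=` U), oset W x /\
    solvable (fun i j => rres O k (B i j)) (pres k \o y)) ->
  solvable B y.
Proof.
move=> [Ubas Ucomp OU] FU ysol.
pose Q D := forall k : D `<=` U,
  solvable (fun i j => rres O k (B i j)) (pres k \o y).
have [x Ux|p [f [D [h [fD QD Dcov unity]]]]] := Ucomp Q.
  have [W [k [Wx /solvable_res ysolW]]] := ysol x Ux.
  have [f [D [h [fD Dx DW]]]] := Ubas W x Ux Wx.
  exists f, D, h; split=> // l; have [z zE] := ysolW D DW; exists z => i /=.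
  rewrite -(pres_comp k DW) [LHS]zE.
  by apply: eq_bigr => j _; rewrite (rres_comp k DW l).
have [q k l kl|q|k] := @uniform_exponent _
    (fun q k => solvable B (fun i => f q ^+ k *: y i)).
- case=> x xE; exists (fun j => f q ^+ (l - k) *: x j) => i.
  rewrite -[in LHS](subnK kl) exprD -scalerA xE scaler_sumr.
  by apply: eq_bigr => j _; rewrite !scalerA; congr (_ *: _); exact: mulrC.
- have [z zE] := QD q (h q).
  have [k [s sE]] := localizes_lift FU (fD q) z.
  (* The lift solves the system only over [D q]; a further power of [f q] kills the error over
     [U]. *)
  have [i|l l0] := localizes_kill FU (fD q)
      (s := fun i => f q ^+ k *: y i - \sum_j B i j *: s j).
    rewrite presD presN presZ [pres _ (y i)]zE rmorphXn scaler_sumr.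
    rewrite (big_morph (pres _) (presD _) (pres0 _ _)); apply/eqP.
    rewrite subr_eq0; apply/eqP/eq_bigr => j _.
    by rewrite presZ sE !scalerA mulrC.
  exists (l + k)%N, (fun j => f q ^+ l *: s j) => i.
  have := l0 i; rewrite scalerBr scalerA -exprD => /eqP.
  rewrite subr_eq0 => /eqP->; rewrite scaler_sumr.
  by apply: eq_bigr => j _; rewrite !scalerA; congr (_ *: _); exact: mulrC.
have [c cE] := unity k.
move=> /choice[x xE]; exists (fun j => \sum_q c q *: x q j) => i.
rewrite -[LHS]scale1r -cE scaler_suml.
under [RHS]eq_bigr do rewrite scaler_sumr.
rewrite exchange_big; apply: eq_bigr => q _ /=.
rewrite -scalerA xE scaler_sumr.
by apply: eq_bigr => j _; rewrite !scalerA; congr (_ *: _); exact: mulrC.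
Qed.

End LocalSystems.

(** * Affine schemes *)

Section PrimeIdeals.
Variable A : comPzRingType.
Implicit Types (S J : set A).

Definition ideal_gen S : set A := [set a | exists n (c g : 'I_n -> A),
  (forall i, S (g i)) /\ a = \sum_i c i * g i].

Lemma ideal_genD S a b : ideal_gen S a -> ideal_gen S b -> ideal_gen S (a + b).
Proof.
move=> [n [c [g [Sg ->]]]] [m [d [h [Sh ->]]]].
pose cas (u : 'I_n -> A) (v : 'I_m -> A) i :=
  match fintype.split i with inl i => u i | inr i => v i end.
exists (n + m)%N, (cas c d), (cas g h).
split=> [i|]; first by rewrite /cas; case: fintype.split.
rewrite big_split_ord /cas; congr (_ + _); apply: eq_bigr => i _.
  by rewrite (unsplitK (inl i)).
by rewrite (unsplitK (inr i)).
Qed.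

Lemma ideal_genM S a b : ideal_gen S b -> ideal_gen S (a * b).
Proof.
move=> [n [c [g [Sg ->]]]]; exists n, (fun i => a * c i), g; split=> //.
by rewrite mulr_sumr; apply: eq_bigr => i _; rewrite mulrA.
Qed.

Lemma ideal_gen_sub S : S `<=` ideal_gen S.
Proof.
by move=> a Sa; exists 1%N, (fun=> 1), (fun=> a); rewrite big_ord1 mul1r.
Qed.

Lemma ideal_gen0 S : ideal_gen S 0.
Proof.
by exists 0%N, (fun=> 0), (fun=> 0); rewrite big_ord0; split=> // -[].
Qed.

(** An ideal maximal among those containing [S] and avoiding all powers of [b] is prime, so the
    radical is the intersection of the primes containing [S]. *)
Lemma radical_gen S b : (forall p : spec A, S `<=` p -> prime_set p b) ->
  exists k, ideal_gen S (b ^+ k).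
Proof.
move=> Sb; apply: contrapT => /forallNP Snb.
pose P : set (set A) := [set J | [/\ forall x y, J x -> J y -> J (x + y),
  forall x y, J y -> J (x * y), forall k, ~ J (b ^+ k)
  & J !=set0 -> ideal_gen S `<=` J]].
have [F FP Ftot|J [[JD JM Jb JS] Jmax]] := @Zorn_bigcup _ P.
  split=> [x y [K FK Kx] [L FL Ly]|x y [K FK Ky]|k [K FK]|[x [K FK Kx]]].
  - have [KL|LK] := Ftot K L FK FL.
      exists L => //; have [LD _ _ _] := FP L FL; exact: LD (KL x Kx) Ly.
    exists K => //; have [KD _ _ _] := FP K FK; exact: KD Kx (LK y Ly).
  - by exists K => //; have [_ KM _ _] := FP K FK; exact: KM.
  - by have [_ _ + _] := FP K FK; exact.
  - move=> y Sy; exists K => //.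
    by have [_ _ _] := FP K FK; apply=> //; exists x.
have {}JS : ideal_gen S `<=` J.
  have [J0|/set0P/JS//] := eqVneq J set0.
  exfalso; apply: (Jmax (ideal_gen S)).
    by rewrite J0; split=> [//|/(_ 0 (@ideal_gen0 S))].
  split=> [x y|x y|k|_] //; first exact: ideal_genD.
  exact: ideal_genM.
(* By maximality the ideal [J + (x)] contains a power of [b]. *)
have Jadd x : ~ J x -> exists k c j, J j /\ b ^+ k = j + c * x.
  move=> Jx; apply: contrapT => /forallNP nb.
  apply: (Jmax [set y | exists c j, J j /\ y = j + c * x]).
    split=> [y Jy|sub]; first by exists 0, y; rewrite mul0r addr0.
    apply: Jx; apply: sub; exists 1, 0; rewrite mul1r add0r; split=> //.
    exact/JS/ideal_gen0.
  split=> [y z|y z|k|_ y /JS Jy].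
  - move=> [c [j [Jj ->]]] [d [i [Ji ->]]]; exists (c + d), (j + i).
    by rewrite mulrDl addrACA; split=> //; exact: JD.
  - move=> [c [j [Jj ->]]]; exists (y * c), (y * j).
    by rewrite mulrDr mulrA; split=> //; exact: JM.
  - by move=> [c [j [Jj bE]]]; apply: (nb k); exists c, j.
  - by exists 0, y; rewrite mul0r addr0.
have J0 : J 0 by exact/JS/ideal_gen0.
have J1 : ~ J 1 by exact: (Jb 0%N).
have Jprime x y : J (x * y) -> J x \/ J y.
  move=> Jxy; apply: contrapT => /not_orP[/Jadd[k [c [j [Jj kE]]]]].
  move=> /Jadd[l [d [i [Ji lE]]]]; apply: (Jb (k + l)%N).
  rewrite exprD kE lE.
  have -> : (j + c * x) * (i + d * y) =
    (i + d * y) * j + ((c * x) * i + (c * d) * (x * y)) by ring.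
  by apply: (JD); [exact: JM|apply: JD; exact: JM].
apply: (Jb 1%N); rewrite expr1; apply: (Sb (Spec J0 JD JM J1 Jprime)).
exact: subset_trans (@ideal_gen_sub S) JS.
Qed.

(** The same [g] must serve every [l]. A prime containing all [g i ^+ l] contains the [g i], hence
    [b], so [radical_gen] applies again to the powers. *)
Lemma radical_gen_finite S b :
  (forall p : spec A, S `<=` p -> prime_set p b) ->
  exists n (g : 'I_n -> A), (forall i, S (g i)) /\
    forall l, exists k (c : 'I_n -> A), b ^+ k = \sum_i c i * g i ^+ l.
Proof.
move=> /radical_gen[k [n [c [g [Sg bE]]]]]; exists n, g; split=> // l.
have primeX (p : spec A) a m : prime_set p (a ^+ m) -> prime_set p a.
  by elim: m => [/prime1//|m IHm]; rewrite exprS => /primeM[].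
have [p gp|m [q [d [h [hg hE]]]]] := @radical_gen [set g i ^+ l | i in setT] b.
  apply: (primeX p b k); rewrite bE; apply: (big_ind (prime_set p)).
  - exact: prime0.
  - exact: primeD.
  - by move=> i _; apply: primeMl; apply: (primeX _ _ l); apply: gp; exists i.
have [i iE] : exists i, forall r, h r = g (i r) ^+ l.
  by exists (fun r => projT1 (cid2 (hg r))) => r; case: cid2.
(* The second combination may repeat or omit powers, so its coefficients are summed by index. *)
exists m, (fun j => \sum_(r | i r == j) d r).
rewrite hE (partition_big i predT) //=; apply: eq_bigr => j _.
by rewrite mulr_suml; apply: eq_bigr => r /eqP <-; rewrite iE.
Qed.

End PrimeIdeals.

Section BasicOpens.
Variable A : comPzRingType.
Implicit Types (a b : A) (p q : spec A).

Lemma open_basic b : open [set p : spec A | ~ prime_set p b].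
Proof.
exists [set b]; apply/seteqP; split=> p /= bp; first by move/(_ b erefl).
by move=> pb; apply: bp => _ ->.
Qed.

Definition basic_open b : opens (spec A) := Opens (open_basic b).

Lemma basic_open_nbhs (V : opens (spec A)) p :
  oset V p -> exists2 b, ~ prime_set p b & basic_open b `<=` V.
Proof.
case: V => V oV /=; have [E ->] : zariski_open V := oV.
move=> /existsNP[b /not_implyP[Eb pb]]; exists b => // q qb Eq.
by apply: qb; exact: Eq.
Qed.

Lemma primeX p a n : prime_set p (a ^+ n) -> prime_set p a.
Proof. by elim: n => [/prime1//|n IHn]; rewrite exprS => /primeM[]. Qed.

Lemma prime_sum p n (c g : 'I_n -> A) :
  (forall i, prime_set p (g i)) -> prime_set p (\sum_i c i * g i).
Proof.
move=> pg; apply: (big_ind (prime_set p)) => [||i _].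
- exact: prime0.
- exact: primeD.
- exact/primeMl/pg.
Qed.

End BasicOpens.

(** * Sections of the sheaf attached to a module *)

Section Structure.
Variables (A : comPzRingType) (M : lmodType A).
Implicit Types (a b : A) (m : M) (p q : spec A) (U V : opens (spec A)).

Lemma frac_eq0 p m (f : denom p) :
  frac m f = 0 <-> exists2 u, ~ prime_set p u & u *: m = 0.
Proof.
rewrite -frac0 fracP; split=> [[u]|[u up um]].
  by rewrite !scaler0 scale1r => um; exists (dval u) => //; exact: dvalP.
by exists (Denom up); rewrite scale1r um !scaler0.
Qed.

(** The annihilator of [m] is contained in no prime avoiding [b], so a power of [b] lies in it. *)
Lemma frac_eq0_basic m b :
  (forall p, ~ prime_set p b -> frac m (denom1 p) = 0) ->
  exists k, b ^+ k *: m = 0.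
Proof.
move=> m0; have [p mp|k [n [c [g [gm bE]]]]] :=
    @radical_gen A [set u | u *: m = 0] b.
  by apply: contrapT => /m0/frac_eq0[u up /mp].
exists k; rewrite bE scaler_suml big1 // => i _.
by rewrite -scalerA gm scaler0.
Qed.

Lemma const_secP U m : locally_basic (L := fracFamily M)
  (fun p (_ : oset U p) => frac m (denom1 p)).
Proof.
move=> p Up; exists U, (fun _ h => h); split=> //.
by exists m, 1 => q Uq; exists (@prime1 _ q).
Qed.

Definition const_sec U m : tilde_sec M U := LSec (@const_secP U m).

End Structure.

Section ConstRing.
Variables (A : comPzRingType) (U : opens (spec A)).

Definition const_ring (a : A) : tilde_sec (selfmod A) U :=
  const_sec (M := selfmod A) U a.

Lemma const_ring_zmod : zmod_morphism const_ring.
Proof.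
move=> a b; apply: lsec_eq => p Up /=.
by rewrite fracN fracD; apply: frac_eq => /=; rewrite !scale1r mulr1 scale1r.
Qed.

Lemma const_ring_monoid : monoid_morphism const_ring.
Proof.
split=> [|a b]; first exact: lsec_eq.
apply: lsec_eq => p Up /=; rewrite [RHS]loc_scaleE; apply: frac_eq.
by rewrite /= mulr1 !scale1r.
Qed.

HB.instance Definition _ :=
  GRing.isZmodMorphism.Build _ _ const_ring const_ring_zmod.
HB.instance Definition _ :=
  GRing.isMonoidMorphism.Build _ _ const_ring const_ring_monoid.

End ConstRing.

(** Finitely many basic opens [D(g i)] on which [t] is a fraction [m i / g i] cover [D(b)]. A power
    of [g i g j] makes the numerators compatible, and a combination [b^k = sum_i c_i g_i^(K+1)]
    glues them. *)
Lemma tilde_structure (A : comPzRingType) (M : lmodType A) (U : opens (spec A))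
    b (t : tilde_sec M U) : (forall p, oset U p <-> ~ prime_set p b) ->
  exists k (m : M), const_ring U (b ^+ k) *: t = const_sec U m.
Proof.
move=> UE.
pose S : set A := [set g | exists m : M, forall q (gq : ~ prime_set q g),
  exists Uq : oset U q, lval t Uq = frac m (Denom gq)].
have [p Sp|n [g [Sg gb]]] := @radical_gen_finite A S b.
  apply: contrapT => /UE Up; have [V [h [Vp [m [f tE]]]]] := lvalP t Up.
  have [e ep eV] := basic_open_nbhs Vp; have [fp _] := tE p Vp.
  (* Passing to the denominator [e * f] makes the fraction valid on the whole basic open of its own
     denominator. *)
  have : ~ prime_set p (e * f) by case/primeM.
  apply; apply: Sp; exists (e *: m) => q efq.
  have eq : ~ prime_set q e.
    by move=> qe; apply: efq; rewrite mulrC; exact: primeMl.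
  exists (h q (eV q eq)); have [fq ->] := tE q (eV q eq).
  by apply: frac_eq; rewrite /= scalerA [f * e]mulrC.
have [m mE] : exists m : 'I_n -> M, forall i q (gq : ~ prime_set q (g i)),
    exists Uq : oset U q, lval t Uq = frac (m i) (Denom gq).
  by exists (fun i => projT1 (cid (Sg i))) => i; exact: projT2 (cid (Sg i)).
have [ij k l kl gm|[i j]|K KE] := @uniform_exponent _
    (fun (ij : 'I_n * 'I_n) k => (g ij.1 * g ij.2) ^+ k *:
      (g ij.2 *: m ij.1 - g ij.1 *: m ij.2) = 0).
- by rewrite -(subnK kl) exprD -scalerA gm scaler0.
- apply: frac_eq0_basic => p /= gijp.
  have gi : ~ prime_set p (g i).
    by move=> gi; apply: gijp; rewrite mulrC; exact: primeMl.
  have gj : ~ prime_set p (g j).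
    by move=> gj; apply: gijp; exact: primeMl.
  have [Up tE] := mE i p gi; have [Up' tE'] := mE j p gj.
  rewrite (fib_irr (lval t) _ Up') tE' in tE.
  have /fracP[u /= uE] := tE.
  apply/frac_eq0; exists (dval u); first exact: dvalP.
  by rewrite scalerBr uE subrr.
(* The exponent is [K.+1]: [K] factors make the numerators comparable, and one more is exchanged
   between [g i m j] and [g j m i]. *)
have [k [c bE]] := gb K.+1.
exists k, (\sum_i c i *: (g i ^+ K *: m i)); apply: lsec_eq => p Up.
have [j gj] : exists j, ~ prime_set p (g j).
  apply: contrapT => /forallNP gp; move/UE: Up; apply; apply: (@primeX _ _ _ k).
  rewrite bE; apply: prime_sum => i; rewrite exprS mulrC; apply: primeMl.
  by apply: contrapT; exact: gp.
have [Up' tE] := mE j p gj.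
rewrite [lval _ _]/= (fib_irr (lval t) _ Up') tE [LHS]loc_scaleE; apply/fracP.
have gjK : ~ prime_set p (g j ^+ K) by move/primeX.
exists (Denom gjK) => /=; rewrite scale1r mul1r !scaler_sumr bE.
rewrite scaler_suml scaler_sumr; apply: eq_bigr => i _.
have /eqP := KE (i, j); rewrite /= scalerBr subr_eq0 => /eqP.
move/(congr1 ( *:%R (c i))); rewrite !scalerA => e.
transitivity ((c i * ((g i * g j) ^+ K * g i)) *: m j).
  by congr (_ *: _); rewrite exprMn exprS; ring.
rewrite mulrA -e; congr (_ *: _); rewrite exprMn; ring.
Qed.

Section AffineSpec.
Variable A : comPzRingType.
Local Notation X := (Spec_ringed A).
Local Notation T := (Opens (@openT (spec A))).
Implicit Types (a b : A) (p : spec A) (D U V W : opens (spec A)).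

Lemma const_ring_res U V (h : V `<=` U) a :
  rres (rsheaf X) h (const_ring U a) = const_ring V a.
Proof. exact: lsec_eq. Qed.

Lemma const_sec_res (M : lmodType A) U V (h : V `<=` U) (m : M) :
  pres (p := tilde M) h (const_sec U m) = const_sec V m.
Proof. exact: lsec_eq. Qed.

Lemma global_const f : exists a, f = const_ring T a.
Proof.
have [|k [a fE]] := @tilde_structure A (selfmod A) T 1 f.
  by move=> p; split=> // _; exact: prime1.
by exists a; rewrite expr1n rmorph1 scale1r in fE.
Qed.

Lemma inv_secP b :
  locally_basic (L := fracFamily (selfmod A)) (U := basic_open b)
  (fun p (bp : oset (basic_open b) p) => frac (1 : selfmod A) (Denom bp)).
Proof.
move=> p bp; exists (basic_open b), (fun _ h => h); split=> //.
by exists 1, b => q bq; exists bq.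
Qed.

(** An inverse on [V] gives one in the local ring at every point [p] of [V], which forces [b]
    outside [p]. *)
Lemma locus_basic b (h : basic_open b `<=` T) :
  @locus X T (basic_open b) h (const_ring T b).
Proof.
split=> [|V k [g gE] p Vp pb].
  exists (LSec (@inv_secP b)); apply: lsec_eq => p bp.
  rewrite [LHS]loc_scaleE; apply: frac_eq => /=.
  by rewrite mul1r scale1r.
move: gE; rewrite const_ring_res.
move=> /(congr1 (fun s : tilde_sec _ V => lval s Vp)).
rewrite [LHS]/=; elim/frac_ind: (lval g Vp) => c d; rewrite [LHS]loc_scaleE.
move=> /fracP[u] /= e; apply: (@denomMP A p u d) => /=.
suff -> : dval u * dval d = dval u * (b * c).
  by rewrite mulrCA mulrC; exact: primeMl.
rewrite scale1r mul1r in e.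
by change (dval u * (b * c) = dval u * (dval d * 1)) in e; rewrite e mulr1.
Qed.

Lemma locus_constP b D (h : D `<=` T) :
  @locus X T D h (const_ring T b) -> D = basic_open b.
Proof.
by move=> bD; apply: (locus_uniq bD (@locus_basic b (fun _ _ => I))).
Qed.

(** A global function is a constant [a], so [D] is a basic open of the spectrum; [frac_eq0_basic]
    gives the kernel and [tilde_structure] the lifts. *)
Lemma localizes_tilde (M : lmodType A) : localizes (tilde M) T.
Proof.
move=> f D h; have [a ->] := global_const f => aD.
have DE : forall p, oset D p <-> ~ prime_set p a by rewrite (locus_constP aD).
split=> [s s0|t].
  have [|k [m sE]] := @tilde_structure A M T 1 s.
    by move=> p; split=> // _; exact: prime1.
  rewrite expr1n rmorph1 scale1r in sE; rewrite {}sE const_sec_res in s0 *.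
  have [p /DE Dp|l ml] := @frac_eq0_basic A M m a.
    exact: (congr1 (fun s : tilde_sec M D => lval s Dp) s0).
  exists l; rewrite -rmorphXn; apply: lsec_eq => p Tp.
  rewrite [LHS]loc_scaleE ml; apply/frac_eq0; exists 1; rewrite ?scaler0 //.
  exact: prime1.
have [k [m tE]] := tilde_structure t DE.
exists k, (const_sec T m); rewrite const_sec_res -tE.
by congr (_ *: _); rewrite const_ring_res rmorphXn.
Qed.

Lemma affine_like_spec : @affine_like X T.
Proof.
split.
- move=> W p _ /basic_open_nbhs[b pb bW].
  exists (const_ring T b), (basic_open b), (fun _ _ => I); split=> //.
  exact: locus_basic.
- move=> Q QT.
  (* A prime containing all [a] with [Q (basic_open a)] would contradict the cover, so these [a]
     generate the unit ideal, and so do the powers of finitely many of them. *)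
  have [p Sp|n [g [Sg gT]]] :=
      @radical_gen_finite A [set a | Q (basic_open a)] 1.
    have [f [D [h []]]] := QT p I.
    have [a ->] := global_const f => /locus_constP -> pa Qa.
    by case: pa; exact: Sp.
  exists n, (fun i => const_ring T (g i)), (fun i => basic_open (g i)).
  exists (fun _ _ _ => I).
  split=> // [i|p _|l]; first exact: locus_basic.
    have [k [c cE]] := gT 1%N; apply: contrapT => /forallNP gp.
    apply: (@prime1 _ p); rewrite -(expr1n A k) cE; apply: prime_sum => i.
    by apply: contrapT; exact: gp.
  have [k [c cE]] := gT l; exists (fun i => const_ring T (c i)).
  rewrite -(rmorph1 (const_ring T)) -(expr1n A k) cE rmorph_sum.
  by apply: eq_bigr => i _; rewrite rmorphM rmorphXn.
- exact: (localizes_tilde (selfmod A)).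
Qed.

End AffineSpec.

(** * Transport along open immersions *)

Section Immersion.
Variables (Y X : ringedSpace) (j : openImmersion Y X).
Implicit Types (V W D : opens Y).

Lemma open_in_range (V : opens X) : V `<=` range j ->
  exists V', V = imageOpen j V'.
Proof.
move=> Vj; have oV : open (j @^-1` V).
  by have /continuousP := @emb_cont _ _ j; apply; exact: open_oset.
exists (Opens oV); apply: opens_sub_eq => [x Vx|_ [y Vy <-]] //.
by have [y _ yx] := Vj x Vx; exists y; rewrite //= yx.
Qed.

Lemma imageOpen_sub V W : imageOpen j V `<=` imageOpen j W -> V `<=` W.
Proof.
by move=> VW y Vy; have [|z Wz /emb_inj <-] := VW (j y); first exists y.
Qed.

Lemma imm_map_unit V W (h : V `<=` W) (k : imageOpen j V `<=` imageOpen j W) f :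
  unit_on k f <-> unit_on h (imm_map j W f).
Proof.
rewrite (Prop_irrelevance k (imageOpenS j h)); split=> -[g fg].
  by exists (imm_map j V g); rewrite -imm_nat -rmorphM fg rmorph1.
have [i iK Ki] := imm_bij j V.
exists (i g); apply: (can_inj iK).
by rewrite rmorphM Ki imm_nat fg rmorph1.
Qed.

(** The opens of [X] inside the image of [W] are the images of opens of [Y], so maximality transfers
    in both directions. *)
Lemma imm_map_locus W D (h : D `<=` W)
    (k : imageOpen j D `<=` imageOpen j W) f :
  locus k f <-> locus h (imm_map j W f).
Proof.
split=> -[uD mD]; split=> [|V l].
- exact/(imm_map_unit h k).
- by move/(imm_map_unit l (imageOpenS j l))/mD/imageOpen_sub.
- exact/(imm_map_unit h k).
have [|V' V'E] := @open_in_range V; first by move=> x /l[y _ <-]; exists y.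
subst V; have l' := imageOpen_sub l.
by move/(imm_map_unit l' l)/mD => VD; exact: (imageOpenS j VD).
Qed.

Lemma localizes_restriction (F : presheafMod X) (G : presheafMod Y)
    (r : restrictionIso j F G) W :
  localizes G W -> localizes F (imageOpen j W).
Proof.
move=> GW f D h fD.
have [|D' D'E] := @open_in_range D; first by move=> x /h[y _ <-]; exists y.
subst D; have k := imageOpen_sub h.
rewrite (Prop_irrelevance h (imageOpenS j k)) in fD *.
have [G0 Gs] := GW _ _ _ ((imm_map_locus k _ _).1 fD).
have r0 V : r V 0 = 0 by apply: (addrI (r V 0)); rewrite -risoD !addr0.
have rX V (a : rsheaf X (imageOpen j V)) n s :
    r V (a ^+ n *: s) = imm_map j V a ^+ n *: r V s by rewrite risoZ rmorphXn.
split=> [s s0|t].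
  have [|n sn] := G0 (r W s); first by rewrite -riso_nat s0 r0.
  by exists n; apply: (bij_inj (riso_bij r W)); rewrite rX sn r0.
have [n [s sE]] := Gs (r D' t); have [i iK Ki] := riso_bij r W.
exists n, (i s); apply: (bij_inj (riso_bij r D')).
by rewrite riso_nat Ki sE rX imm_nat.
Qed.

Definition struct_restriction :
    restrictionIso j (struct_sheaf X) (struct_sheaf Y).
Proof.
refine (@RestrictionIso _ _ j (struct_sheaf X) (struct_sheaf Y)
  (fun W => imm_map j W) (imm_bij j) _ _ (@imm_nat _ _ j)).
- by move=> W s t; exact: rmorphD.
- by move=> W a s; exact: rmorphM.
Defined.

Lemma affine_like_image W : affine_like W -> affine_like (imageOpen j W).
Proof.
move=> [Wbas Wcomp OW].
split; [|move=> Q QW|exact: (localizes_restriction struct_restriction)].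
- move=> V _ [y Wy <-] Vy.
  have [|V' V'E] := @open_in_range (opensI V (imageOpen j W)).
    by move=> x [_ [z _ <-]]; exists z.
  have /imageOpen_sub V'W : imageOpen j V' `<=` imageOpen j W.
    by rewrite -V'E; exact: opensIr.
  have V'y : oset V' y.
    have [z V'z /emb_inj <- //] : oset (imageOpen j V') (j y).
    by rewrite -V'E; split=> //; exists y.
  have [f [D [h [fD Dy DV]]]] := Wbas V' y Wy V'y.
  have [i iK Ki] := imm_bij j W.
  exists (i f), (imageOpen j D), (imageOpenS j h); split; last 2 first.
  + by exists y.
  + have V'V : imageOpen j V' `<=` V by rewrite -V'E; exact: opensIl.
    exact: subset_trans (imageOpenS j DV) V'V.
  by apply/(imm_map_locus h); rewrite Ki.
have [y Wy|n [f [D [h [fD QD Dcov unity]]]]] := Wcomp (Q \o imageOpen j).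
  have [|f [D [k [fD Dy QD]]]] := QW (j y); first by exists y.
  have [|D' D'E] := @open_in_range D; first by move=> x /k[z _ <-]; exists z.
  subst D; have h := imageOpen_sub k.
  exists (imm_map j W f), D', h; split=> //; first exact/(imm_map_locus h k).
  by case: Dy => z Dz /emb_inj <-.
have [i iK Ki] := imm_bij j W.
exists n, (fun p => i (f p)), (fun p => imageOpen j (D p)).
exists (fun p => imageOpenS j (h p)).
split=> // [p|_ [y Wy <-]|k].
- by apply/(imm_map_locus (h p)); rewrite Ki.
- by have [p Dy] := Dcov y Wy; exists p; exists y.
have [c cE] := unity k; exists (fun p => i (c p)).
apply: (can_inj iK); rewrite rmorph1 -cE rmorph_sum.
by apply: eq_bigr => p _; rewrite rmorphM rmorphXn !Ki.
Qed.

End Immersion.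

Lemma image_top (A : comPzRingType) (X : ringedSpace)
    (j : openImmersion (Spec_ringed A) X) (U : opens X) :
  (U : set X) = range j -> U = imageOpen j (Opens (@openT (spec A))).
Proof. by move=> Uj; apply: opens_eq. Qed.

Lemma affine_openP (X : ringedSpace) (U : opens X) :
  affine_open U -> affine_like U.
Proof.
move=> [A [j /image_top ->]]; exact: affine_like_image (affine_like_spec A).
Qed.

(** Quasi-coherence describes [F] only on some neighbourhood of each point; [localizes_local]
    carries the property over to an arbitrary affine open. *)
Lemma localizes_affine (X : ringedSpace) (F : sheafMod X) (U : opens X) :
  quasi_coherent F -> affine_open U -> localizes F U.
Proof.
move=> qcF /affine_openP Uaff; apply: localizes_local => // x _.
have [A [j [M [jx [r]]]]] := qcF x.
exists (imageOpen j (Opens (@openT (spec A)))); split=> //.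
  exact: affine_like_image (affine_like_spec A).
exact: (localizes_restriction r (localizes_tilde M)).
Qed.

(** * Purity of sheaves *)

Lemma tensor_res_sum (X : ringedSpace) (M F : presheafMod X) (U V : opens X)
    (h : V `<=` U) m (e : 'I_m -> M U) (y : 'I_m -> F U) :
  tensor_res h (\sum_i ptens (e i) (y i)) =
  \sum_i ptens (pres h (e i)) (pres h (y i)).
Proof.
pose s := [seq (e i, y i) | i <- enum 'I_m].
have -> : \sum_i ptens (e i) (y i) = tpi s by rewrite tpi_sum big_map big_enum.
by rewrite tensor_resE tpi_sum big_map /s big_map big_enum.
Qed.

Lemma germ_eq0 (X : ringedSpace) (P : presheafMod X) x (U : opens X)
    (Ux : oset U x) (s : P U) :
  germ Ux s = 0 <->
  exists (V : opens X) (h : V `<=` U), oset V x /\ pres h s = 0.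
Proof.
split=> [|[V [h [Vx s0]]]]; last by rewrite -(germ_res h Ux Vx) s0 germ0.
rewrite -(germ0 P Ux) => /germP[V [h [k [Vx]]]]; rewrite pres0 => s0.
by exists V, h.
Qed.

Lemma exact_mono_inj (X : ringedSpace) (F G : sheafMod X) (f : modHom F G) U :
  exact_mono f -> injective (f U).
Proof.
move=> f0 s t st; apply/eqP; rewrite -subr_eq0; apply/eqP/f0.
by rewrite linearB st subrr.
Qed.

Lemma locally_pure_sheaf (X : scheme) (F : sheafMod X) :
  locally_coherent X -> quasi_coherent F ->
  locally_absolutely_pure F -> absolutely_pure_sheaf F.
Proof.
move=> Xcoh qcF Fpure G f fmono M U s s0; apply: lsec_eq => x Ux.
have [V [h [Vx [t st]]]] := lvalP s Ux.
have := congr1 (fun s : tensor_sheaf M G U => lval s Ux) s0.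
rewrite [RHS]/= [LHS]/= (fib_irr (lval s) Ux (h x Vx)) st stalk_mapE.
move/germ_eq0 => [W [k [Wx]]]; rewrite -mhom_nat.
case/tensor_kernel => m [n [e [y [B [tE Be ysol]]]]].
(* [W] need not be affine, so the system is restricted to a basic open of an affine open around
   [x]. *)
have [U' [U'aff U'x]] := scheme_affine x.
have [U'bas _ OU'] := affine_openP U'aff.
have [g [D [l [gD Dx DW]]]] := U'bas W x U'x Wx.
(* Solvability in [G] gives consistency there, which descends to [F] because [f] is injective on
   sections. *)
have Bcons : consistent (fun i j => rres _ DW (B i j)) (pres DW \o y).
  apply: (consistent_ext (exact_mono_inj (U := D) fmono)).
  have := solvable_consistent (solvable_res DW ysol).
  by congr consistent; apply/funext => i /=; rewrite mhom_nat.
have [z zE] := solvable_locus OU' (localizes_affine qcF U'aff) (Xcoh _ U'aff)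
  (Fpure _ U'aff) gD Bcons.
apply/germ_eq0; exists D, (fun y Dy => k y (DW y Dy)); split=> //.
rewrite -(pres_comp k DW) tE [LHS]tensor_res_sum.
apply: ptens_sum_eq0 zE _ => j; rewrite -[RHS](pres0 _ DW) -(Be j).
rewrite (big_morph (pres DW) (presD DW) (pres0 _ DW)).
by apply: eq_bigr => i _; rewrite presZ.
Qed.

(* The maps [rho] respect identities only modulo [S]: this accommodates       *)
(* extension by zero, where [S U] is everything outside the support.          *)
Section QuotientSheaf.
Variables (X : ringedSpace) (E : forall U : opens X, lmodType (rsheaf X U)).
Variables (S : forall U, set (E U)).
Implicit Types (U V W : opens X).
Variable rho : forall U V : opens X, V `<=` U -> E U -> E V.
Hypotheses (S0 : forall U, S (0 : E U))
  (SD : forall U (u v : E U), S u -> S v -> S (u + v))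
  (SZ : forall U a (u : E U), S u -> S (a *: u)).
Hypotheses (rhoD : forall (U V : opens X) (h : V `<=` U),
    {morph rho h : u v / u + v})
  (rhoZ : forall (U V : opens X) (h : V `<=` U) a u,
    rho h (a *: u) = rres _ h a *: rho h u)
  (rhoS : forall (U V : opens X) (h : V `<=` U) u, S u -> S (rho h u))
  (rho_id : forall (U : opens X) (h : U `<=` U) u, S (rho h u - u))
  (rho_comp : forall (U V W : opens X) (h1 : V `<=` U) (h2 : W `<=` V)
    (h3 : W `<=` U) u, rho h2 (rho h1 u) = rho h3 u).

Let Q U := quomod (@S0 U) (@SD U) (@SZ U).
Let q U : {linear E U -> Q U} := qpi (@S0 U) (@SD U) (@SZ U).

Definition quo_res (U V : opens X) (h : V `<=` U) (x : Q U) : Q V :=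
  q V (rho h (repr x)).

Lemma quo_resE (U V : opens X) (h : V `<=` U) u :
  quo_res h (q U u) = q V (rho h u).
Proof.
apply/qpiP; have rhoB v w : rho h (v - w) = rho h v - rho h w.
  by rewrite -!scaleN1r rhoD rhoZ rmorphN rmorph1.
by rewrite -rhoB; apply: rhoS; have /qpiP := qpiK (q U u).
Qed.

Definition quo_presheaf : presheafMod X.
Proof.
refine (@PresheafMod X Q quo_res _ _ _ _).
- move=> U V h; elim/quo_ind=> u; elim/quo_ind=> v.
  by rewrite -!/(q _ _) -linearD !quo_resE rhoD linearD.
- move=> U V h a; elim/quo_ind=> u.
  by rewrite -!/(q _ _) -linearZ !quo_resE rhoZ linearZ.
- by move=> U h; elim/quo_ind=> u; rewrite quo_resE; apply/qpiP.
- move=> U V W h1 h2 h3; elim/quo_ind=> u.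
  by rewrite (quo_resE h1) (quo_resE h2) (quo_resE h3) (rho_comp h1 h2 h3).
Defined.

Definition quo_sheaf : sheafMod X := sheafify quo_presheaf.

Lemma quo_secP U (u : E U) : locally_basic (L := germFamily quo_presheaf)
  (fun x Ux => germ Ux (q U u : quo_presheaf U)).
Proof.
by move=> x Ux; exists U, (fun _ h => h); split=> //; exists (q U u).
Qed.

Definition quo_sec_fun U (u : E U) : quo_sheaf U := LSec (quo_secP u).

Lemma quo_sec_linear U : linear (@quo_sec_fun U).
Proof.
move=> a u v; apply: lsec_eq => x Ux /=.
by rewrite (stalk_scaleE (fun _ h => h)) rres_id -germD -linearZ -linearD.
Qed.

HB.instance Definition _ U := GRing.isLinear.Build (rsheaf X U) (E U)
  (quo_sheaf U) *:%R (@quo_sec_fun U) (@quo_sec_linear U).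

Definition quo_sec U : {linear E U -> quo_sheaf U} := @quo_sec_fun U.

Lemma quo_sec_res (U V : opens X) (h : V `<=` U) u :
  pres h (quo_sec U u) = quo_sec V (rho h u).
Proof.
apply: lsec_eq => x Vx /=.
by rewrite -(germ_res h (h x Vx) Vx) -quo_resE.
Qed.

Lemma quo_sec_eq0 U (u : E U) : quo_sec U u = 0 -> forall x, oset U x ->
  exists (V : opens X) (h : V `<=` U), oset V x /\ S (rho h u).
Proof.
move=> u0 x Ux; have := congr1 (fun s : quo_sheaf U => lval s Ux) u0.
move=> /germ_eq0[V [h [Vx e]]]; exists V, h; split=> //.
by apply/(qpi_eq0 (@S0 V) (@SD V) (@SZ V)); rewrite -[RHS]e -quo_resE.
Qed.

Lemma quo_sec_rel U (u : E U) : S u -> quo_sec U u = 0.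
Proof.
move=> Su; apply: lsec_eq => x Ux; apply/germ_eq0; exists U, (fun _ h => h).
split=> //; have /(qpi_eq0 (@S0 U) (@SD U) (@SZ U)) u0 := Su.
by rewrite pres_id.
Qed.

Lemma quo_sec_local U (s : quo_sheaf U) x : oset U x ->
  exists (V : opens X) (h : V `<=` U), oset V x /\
    exists u, pres h s = quo_sec V u.
Proof.
move=> Ux; have [V [h [Vx [t tE]]]] := lvalP s Ux; exists V, h; split=> //.
exists (repr t); apply: lsec_eq => y Vy /=; rewrite tE.
by congr germ; rewrite -[LHS]qpiK.
Qed.

End QuotientSheaf.

(** Intersecting one neighbourhood at a time brings finitely many local choices onto a common
    neighbourhood. *)
Lemma finite_shrink (X : topologicalType) (U : opens X) x n
    (P : 'I_n -> opens X -> Prop) : oset U x ->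
  (forall i (V W : opens X), W `<=` V -> P i V -> P i W) ->
  (forall i, exists V : opens X, [/\ oset V x, V `<=` U & P i V]) ->
  exists V : opens X, [/\ oset V x, V `<=` U & forall i, P i V].
Proof.
move=> Ux; elim: n P => [|n IHn] P Psub PV; first by exists U; split=> // -[].
have [|i|V [Vx VU VP]] := IHn (fun i => P (lift ord0 i)).
- by move=> i V W; exact: Psub.
- exact: PV.
have [W [Wx WU WP]] := PV ord0; exists (opensI V W); split=> // [y []|i].
  by move=> /VU.
have [i' ->|->] := unliftP ord0 i.
  exact: Psub (@opensIl _ V W) (VP i').
exact: Psub (@opensIr _ V W) WP.
Qed.

Lemma locally_zero (X : ringedSpace) (F : sheafMod X) (U : opens X) (s : F U) :
  (forall x, oset U x ->
    exists (V : opens X) (h : V `<=` U), oset V x /\ pres h s = 0) ->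
  s = 0.
Proof.
move=> s0; pose I := {V : opens X | exists h : V `<=` U, pres h s = 0}.
pose VU (i : I) : sval i `<=` U := projT1 (cid (svalP i)).
apply: (sheaf_separated (@sheafMod_sheaf _ F) (@pres_comp _ F) (VU := VU)).
  by move=> x /s0[V [h [Vx sV]]]; exists (exist _ V (ex_intro _ h sV)).
by move=> i; rewrite pres0; exact: projT2 (cid (svalP i)).
Qed.

(** * The universal extension and the test module of a system over an open set *)

Section Universal.
Variables (X : ringedSpace) (F : sheafMod X) (U : opens X) (m n : nat).
Local Notation O := (rsheaf X).
Variables (B : 'I_m -> 'I_n -> O U) (y : 'I_m -> F U).
Implicit Types (V W : opens X).

(* Restriction in the extension by zero of [O_U^k]. *)
Definition ext_res k W V (h : V `<=` W) (v : 'rV[O W]_k) : 'rV[O V]_k :=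
  if `[< W `<=` U >] then map_mx (rres O h) v else 0.

Lemma ext_resE k W V (h : V `<=` W) (v : 'rV[O W]_k) :
  W `<=` U -> ext_res h v = map_mx (rres O h) v.
Proof. by move=> WU; rewrite /ext_res asboolT. Qed.

Lemma ext_resD k W V (h : V `<=` W) :
  {morph @ext_res k W V h : u v / u + v}.
Proof.
by move=> u v; rewrite /ext_res; case: ifP; rewrite ?map_mxD ?addr0.
Qed.

Lemma ext_resZ k W V (h : V `<=` W) a (v : 'rV[O W]_k) :
  ext_res h (a *: v) = rres O h a *: ext_res h v.
Proof. by rewrite /ext_res; case: ifP; rewrite ?map_mxZ ?scaler0. Qed.

Lemma ext_res0 k W V (h : V `<=` W) : ext_res h (0 : 'rV[O W]_k) = 0.
Proof. by rewrite /ext_res; case: ifP; rewrite ?map_mx0. Qed.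

Lemma ext_res_comp k W V V' (h1 : V `<=` W) (h2 : V' `<=` V) (h3 : V' `<=` W)
    (v : 'rV[O W]_k) : ext_res h2 (ext_res h1 v) = ext_res h3 v.
Proof.
have [WU|nWU] := asboolP (W `<=` U).
  rewrite (ext_resE h1) // (ext_resE h3) // ext_resE; last first.
    exact: subset_trans WU.
  by apply/matrixP => i j; rewrite !mxE (rres_comp h1 h2 h3).
rewrite /ext_res (asboolF nWU); case: ifP => // _.
by apply/matrixP => i j; rewrite !mxE rmorph0.
Qed.

(** When [W] does not lie in [U] every vector is a relation, so the presheaf quotient is zero there
    and the sheaf is the cokernel extended by zero. *)
Definition ext_coker_rel W : set 'rV[O W]_m :=
  [set v | forall h : W `<=` U, coker_rel (fun i j => rres O h (B i j)) v].

Lemma ext_coker_rel0 W : @ext_coker_rel W 0.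
Proof. by move=> h; exact: coker_rel0. Qed.

Lemma ext_coker_relD W u v :
  @ext_coker_rel W u -> @ext_coker_rel W v -> @ext_coker_rel W (u + v).
Proof. by move=> Su Sv h; apply: coker_relD; [exact: Su|exact: Sv]. Qed.

Lemma ext_coker_relZ W a u : @ext_coker_rel W u -> @ext_coker_rel W (a *: u).
Proof. by move=> Su h; apply: coker_relZ; exact: Su. Qed.

Lemma ext_coker_rel_res W V (h : V `<=` W) u :
  @ext_coker_rel W u -> @ext_coker_rel V (ext_res h u).
Proof.
move=> Su k; rewrite /ext_res; case: asboolP => [l|_]; last exact: coker_rel0.
have [c cE] := Su l; exists (fun j => rres O h (c j)) => i.
rewrite mxE cE rmorph_sum; apply: eq_bigr => j _.
by rewrite rmorphM (rres_comp l h k).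
Qed.

Lemma ext_coker_rel_id W (h : W `<=` W) u : @ext_coker_rel W (ext_res h u - u).
Proof.
move=> k; rewrite ext_resE //; have -> : map_mx (rres O h) u = u.
  by apply/matrixP => i j; rewrite mxE rres_id.
by rewrite subrr; exact: coker_rel0.
Qed.

Definition coker_sheaf : sheafMod X :=
  quo_sheaf ext_coker_rel0 ext_coker_relD ext_coker_relZ (@ext_resD m)
    (@ext_resZ m) ext_coker_rel_res ext_coker_rel_id (@ext_res_comp m).

(** When [W] does not lie in [U] the vectors are killed and [F W] is left unchanged, so that a
    solution is adjoined only over [U]. *)
Definition ext_pushout_rel W : set (F W * 'rV[O W]_n) :=
  [set u : F W * 'rV[O W]_n | (forall h : W `<=` U,
     pushout_rel (fun i j => rres O h (B i j)) (pres h \o y) u) /\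
   (~ W `<=` U -> u.1 = 0)].

Lemma ext_pushout_rel0 W : @ext_pushout_rel W 0.
Proof. by split=> // h; exact: pushout_rel0. Qed.

Lemma ext_pushout_relD W u v :
  @ext_pushout_rel W u -> @ext_pushout_rel W v -> @ext_pushout_rel W (u + v).
Proof.
move=> [Su u0] [Sv v0]; split=> [h|nWU].
  by apply: pushout_relD; [exact: Su|exact: Sv].
by rewrite /= u0 // v0 // addr0.
Qed.

Lemma ext_pushout_relZ W a u :
  @ext_pushout_rel W u -> @ext_pushout_rel W (a *: u).
Proof.
move=> [Su u0]; split=> [h|nWU]; first by apply: pushout_relZ; exact: Su.
by rewrite /= u0 // scaler0.
Qed.

Definition pair_res W V (h : V `<=` W) (u : F W * 'rV[O W]_n) :
  F V * 'rV[O V]_n := (pres h u.1, ext_res h u.2).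

Lemma pair_resD W V (h : V `<=` W) : {morph pair_res h : u v / u + v}.
Proof. by move=> u v; rewrite /pair_res presD ext_resD. Qed.

Lemma pair_resZ W V (h : V `<=` W) a u :
  pair_res h (a *: u) = rres O h a *: pair_res h u.
Proof. by rewrite /pair_res presZ ext_resZ. Qed.

Lemma pair_res_comp W V V' (h1 : V `<=` W) (h2 : V' `<=` V) (h3 : V' `<=` W) u :
  pair_res h2 (pair_res h1 u) = pair_res h3 u.
Proof. by rewrite /pair_res (pres_comp h1 h2 h3) (ext_res_comp h1 h2 h3). Qed.

Lemma ext_pushout_rel_res W V (h : V `<=` W) u :
  @ext_pushout_rel W u -> @ext_pushout_rel V (pair_res h u).
Proof.
move=> [Su u0]; split=> [k|nVU]; last first.
  by rewrite /= u0 ?pres0 // => WU; apply: nVU; exact: subset_trans WU.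
rewrite /pair_res /ext_res; case: asboolP => [l|nWU]; last first.
  by rewrite u0 // pres0; exact: pushout_rel0.
have [r [u1 u2]] := Su l; exists (fun i => rres O h (r i)); split=> [|j] /=.
  rewrite u1 (big_morph (pres h) (presD h) (pres0 _ h)).
  by apply: eq_bigr => i _; rewrite presZ /= (pres_comp l h k).
rewrite mxE u2 rmorphN rmorph_sum; congr (- _); apply: eq_bigr => i _.
by rewrite rmorphM (rres_comp l h k).
Qed.

Lemma ext_pushout_rel_id W (h : W `<=` W) u :
  @ext_pushout_rel W (pair_res h u - u).
Proof.
split=> [k|_] /=; last by rewrite pres_id subrr.
rewrite /pair_res ext_resE // pres_id; have -> : map_mx (rres O h) u.2 = u.2.
  by apply/matrixP => i j; rewrite mxE rres_id.
by rewrite -surjective_pairing subrr; exact: pushout_rel0.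
Qed.

Definition pushout_sheaf : sheafMod X :=
  quo_sheaf (E := fun W => (F W * 'rV[O W]_n)%type) ext_pushout_rel0
    ext_pushout_relD ext_pushout_relZ pair_resD pair_resZ ext_pushout_rel_res
    ext_pushout_rel_id pair_res_comp.

Definition coker_sec W : {linear 'rV[O W]_m -> coker_sheaf W} :=
  quo_sec ext_coker_rel0 ext_coker_relD ext_coker_relZ (@ext_resD m)
    (@ext_resZ m) ext_coker_rel_res ext_coker_rel_id (@ext_res_comp m) W.

Lemma coker_sec_res W V (h : V `<=` W) u :
  pres h (coker_sec W u) = coker_sec V (ext_res h u).
Proof. exact: quo_sec_res. Qed.

Lemma coker_sec_eq0 W u : coker_sec W u = 0 -> forall x, oset W x ->
  exists V (h : V `<=` W), oset V x /\ ext_coker_rel (ext_res h u).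
Proof. exact: quo_sec_eq0. Qed.

Lemma coker_sec_local W (s : coker_sheaf W) x : oset W x ->
  exists V (h : V `<=` W), oset V x /\ exists u, pres h s = coker_sec V u.
Proof. exact: quo_sec_local. Qed.

Definition pushout_sec W :
    {linear (F W * 'rV[O W]_n)%type -> pushout_sheaf W} :=
  quo_sec (E := fun W => (F W * 'rV[O W]_n)%type) ext_pushout_rel0
    ext_pushout_relD ext_pushout_relZ pair_resD pair_resZ ext_pushout_rel_res
    ext_pushout_rel_id pair_res_comp W.

Lemma pushout_sec_res W V (h : V `<=` W) u :
  pres h (pushout_sec W u) = pushout_sec V (pair_res h u).
Proof. exact: quo_sec_res. Qed.

Lemma pushout_sec_eq0 W u : pushout_sec W u = 0 -> forall x, oset W x ->
  exists V (h : V `<=` W), oset V x /\ ext_pushout_rel (pair_res h u).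
Proof. exact: quo_sec_eq0. Qed.

Definition pushout_hom_fun W (s : F W) : pushout_sheaf W :=
  pushout_sec W (s, 0).

Lemma pushout_hom_linear W : linear (@pushout_hom_fun W).
Proof.
move=> a s t; rewrite /pushout_hom_fun -linearP; congr (pushout_sec W _).
by apply: injective_projections; rewrite /= ?scaler0 ?addr0.
Qed.

HB.instance Definition _ W := GRing.isLinear.Build (O W) (F W)
  (pushout_sheaf W) *:%R (@pushout_hom_fun W) (@pushout_hom_linear W).

Definition pushout_hom : modHom F pushout_sheaf.
Proof.
exists (fun W => @pushout_hom_fun W : {linear _ -> _}) => W V h s.
change (pushout_sec V (pres h s, 0) = pres h (pushout_sec W (s, 0))).
by rewrite pushout_sec_res /pair_res ext_res0.
Defined.

Lemma pushout_homE i :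
  pushout_hom U (y i) = \sum_j B i j *: pushout_sec U (0, delta_mx 0 j).
Proof.
apply/eqP; rewrite -subr_eq0 -[pushout_hom U _]/(pushout_sec U _).
under eq_bigr do rewrite -linearZ.
rewrite -linear_sum -linearB; apply/eqP/quo_sec_rel.
split=> [h|/(_ (fun _ k => k))//].
have := pushout_rel_gen (fun i j => rres O h (B i j)) (pres h \o y) i.
by rewrite /= pres_id; under eq_bigr do rewrite rres_id.
Qed.

Lemma coker_gen_eq0 j : \sum_i B i j *: coker_sec U (delta_mx 0 i) = 0.
Proof.
under eq_bigr do rewrite -linearZ.
rewrite -linear_sum; apply: quo_sec_rel => h.
have := coker_rel_gen (fun i j => rres O h (B i j)) j.
by under eq_bigr do rewrite rres_id.
Qed.

End Universal.

(** A tensor over [U] defines a section of the sheafified tensor product. Purity kills that section,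
    and vanishing of its germs means vanishing near each point. *)
Lemma exact_tensor_hom (X : ringedSpace) (M F G : sheafMod X) (f : modHom F G)
    (U : opens X) (t : tensor_presheaf M F U) :
  exact_mono (tensor_hom M f) -> tens_map (@id (M U)) (f U) t = 0 ->
  forall x, oset U x ->
    exists (V : opens X) (h : V `<=` U), oset V x /\ tensor_res h t = 0.
Proof.
move=> fpure ft0 x Ux.
have sP : locally_basic (L := germFamily (tensor_presheaf M F))
    (fun x (Ux : oset U x) => germ Ux t).
  by move=> z Uz; exists U, (fun _ h => h); split=> //; exists t.
have /(congr1 (fun s : tensor_sheaf M F U => lval s Ux)) : LSec sP = 0.
  apply: fpure; apply: lsec_eq => z Uz.
  by rewrite /= stalk_mapE /= [X in germ _ X]ft0 germ0.
by move/germ_eq0.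
Qed.

(** Near a point, a section killed by the map either is zero, on an open not contained in [U], or
    equals [sum_i r i y_i] with [r B = 0]; on a basic open of [U] consistency persists and makes it
    zero. *)
Lemma pushout_hom_mono (X : ringedSpace) (F : sheafMod X) (U : opens X) m n
    (B : 'I_m -> 'I_n -> rsheaf X U) (y : 'I_m -> F U) :
  affine_like U -> consistent B y -> exact_mono (pushout_hom B y).
Proof.
move=> [Ubas _ OU] By W s s0; apply: locally_zero => x Wx.
have [V [h [Vx [relU relN]]]] := pushout_sec_eq0 s0 Wx.
have [VU|nVU] := pselect (V `<=` U); last first.
  by exists V, h; split=> //; exact: relN.
have [r [sE rB]] := relU VU.
have [g [D [k [gD Dx DV]]]] := Ubas V x (VU x Vx) Vx.
exists D, (fun z Dz => h z (DV z Dz)); split=> //.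
have rD j : \sum_i rres (rsheaf X) DV (r i) * rres (rsheaf X) k (B i j) = 0.
  have := rB j; rewrite /= ext_res0 mxE => /esym/eqP.
  rewrite oppr_eq0 => /eqP/(congr1 (rres _ DV)).
  rewrite rmorph0 rmorph_sum => rB0; rewrite -[RHS]rB0.
  by apply: eq_bigr => i _; rewrite rmorphM (rres_comp VU DV k).
rewrite -[RHS](consistent_locus OU gD By rD) -(pres_comp h DV) [pres h s]sE.
rewrite (big_morph (pres DV) (presD DV) (pres0 _ DV)).
by apply: eq_bigr => i _; rewrite presZ /= (pres_comp VU DV k).
Qed.

Lemma pure_sheaf_locally (X : scheme) (F : sheafMod X) :
  quasi_coherent F -> absolutely_pure_sheaf F -> locally_absolutely_pure F.
Proof.
move=> qcF Fpure U Uaff; apply: solvable_pure => m n B y Bcons.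
apply: (solvable_local (affine_openP Uaff) (localizes_affine qcF Uaff)) => x Ux.
pose M := coker_sheaf B; pose e i : M U := coker_sec B U (delta_mx 0 i).
have fmono := pushout_hom_mono (affine_openP Uaff) Bcons.
have [|W [h [Wx]]] := exact_tensor_hom (t := \sum_i ptens (e i) (y i))
  (Fpure _ _ fmono M) _ Ux.
  rewrite tens_map_sum.
  by apply: (ptens_sum_eq0 (pushout_homE B y)) => j; exact: coker_gen_eq0.
rewrite tensor_res_sum => /tensor_vanishing[k [l [z [mu [B' [C [yE Cz Be]]]]]]].
have eW (V : opens X) (VW : V `<=` W) i :
    pres VW (pres h (e i)) = coker_sec B V (delta_mx 0 i).
  rewrite (pres_comp h VW (subset_trans VW h)) coker_sec_res ext_resE //.
  by rewrite map_delta_mx.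
(* The [mu i] are sections of a sheafification; near [x] they come from vectors [w i]. *)
pose loc i (V : opens X) := exists (VW : V `<=` W) w,
  pres VW (mu i) = coker_sec B V w.
have [i V V' V'V [VW [w wE]]|i|V [Vx VW muV]] := @finite_shrink _ W x _ loc Wx.
- exists (subset_trans V'V VW), (ext_res U V'V w).
  by rewrite -coker_sec_res -wE (pres_comp VW V'V (subset_trans V'V VW)).
- have [V [VW [Vx [w wE]]]] := coker_sec_local (mu i) Wx.
  by exists V; split=> //; exists VW, w.
have /choice[w wE] i : exists w, pres VW (mu i) = coker_sec B V w.
  by have [VW' [w wE]] := muV i; exists w; rewrite (Prop_irrelevance VW VW').
(* The class of [u j] is the [j]-th relation between the [e i] and the [mu i], hence zero; on a
   smaller open the vector itself lies in the column space of [B]. *)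
pose u j := \row_i rres (rsheaf X) VW (B' i j) +
  \sum_i rres (rsheaf X) VW (C i j) *: w i.
have u0 j : coker_sec B V (u j) = 0.
  rewrite -[RHS](pres0 _ VW) -(Be j) presD linearD (row_sum_delta (\row_i _)).
  rewrite !linear_sum !(big_morph (pres VW) (presD VW) (pres0 _ VW)).
  congr (_ + _); apply: eq_bigr => i _; rewrite linearZ presZ.
    by rewrite mxE eW.
  by rewrite wE.
pose rel j (V' : opens X) := exists h : V' `<=` V,
  ext_coker_rel B (ext_res U h (u j)).
have [j V1 V2 V21 [V1V uj]|j|V' [V'x V'V urel]] :=
    @finite_shrink _ V x _ rel Vx.
- exists (subset_trans V21 V1V).
  rewrite -(ext_res_comp U V1V V21 (subset_trans V21 V1V)).
  exact: ext_coker_rel_res.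
- have [V' [V'V [V'x uj]]] := coker_sec_eq0 (u0 j) Vx.
  by exists V'; split=> //; exists V'V.
have V'W := subset_trans V'V VW; have V'U := subset_trans V'W h.
exists V', V'U; split=> //.
apply: (@coker_solvable _ _ _ _ _ _ k l (pres V'W \o z)
  (fun i => map_mx (rres (rsheaf X) V'V) (w i))
  (fun i j => rres (rsheaf X) V'W (B' i j))
  (fun i j => rres (rsheaf X) V'W (C i j))) => [i|i|j] /=.
- rewrite -(pres_comp h V'W) yE (big_morph (pres V'W) (presD _) (pres0 _ _)).
  by apply: eq_bigr => j _; rewrite presZ.
- rewrite -[RHS](pres0 _ V'W) -(Cz i).
  rewrite (big_morph (pres V'W) (presD _) (pres0 _ _)).
  by apply: eq_bigr => j _; rewrite presZ.
have [V'V' /(_ V'U)] := urel j; rewrite (Prop_irrelevance V'V' V'V).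
rewrite ext_resE; last exact: subset_trans VW h.
congr coker_rel; apply/matrixP => i' i.
rewrite /u !mxE !summxE rmorphD rmorph_sum (rres_comp VW V'V V'W).
congr (_ + _); apply: eq_bigr => p _.
by rewrite !mxE rmorphM (rres_comp VW V'V V'W).
Qed.

Theorem lemma5p8 (X : scheme) (hX : locally_coherent X)
    (F : sheafMod X) (hF : quasi_coherent F) :
  locally_absolutely_pure F <-> absolutely_pure_sheaf F.
Proof. by split; [exact: locally_pure_sheaf|exact: pure_sheaf_locally]. Qed.
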